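(* The bilinear form $a(\cdot,\cdot)$ is coercive on the discrete kernel $\operatorname{Ker}(B_h):=\{\underline{\boldsymbol\tau}_h\in\underline{\boldsymbol\Sigma}_h: b(\underline{\boldsymbol\tau}_h,\mathbf v_h)=0\ \ \forall\,\mathbf v_h\in\mathbf V_h\}$: there is a constant $c>0$ independent of the mesh size such that $$a(\underline{\boldsymbol\tau}_h,\underline{\boldsymbol\tau}_h)\ge c\,\|\underline{\boldsymbol\tau}_h\|_{\underline{\boldsymbol\Sigma}_h}^2\qquad\forall\,\underline{\boldsymbol\tau}_h\in\operatorname{Ker}(B_h).$$
   Context: $\Omega\subset\mathbb R^3$ is a bounded, connected, polyhedral domain with Lipschitz boundary and outer unit normal $\mathbf n$. The boundary is split into two closed parts $\Gamma_D$ (non-trivial) and $\Gamma_N=\partial\Omega\setminus\mathrm{int}(\Gamma_D)$ (possibly empty), each a union of polygonal boundary faces of $\Omega$. For each connected component $\Gamma_{D,i}$ of $\Gamma_D$ there is an open Lipschitz domain $\Omega_{D,i}\subset\mathbb R^3$ with $\overline{\Omega}_{D,i}\cap\overline\Omega=\Gamma_{D,i}$ and $\Omega_{D,i}\cap\Omega=\emptyset$, these domains have mutually positive distance, and the interior of $\overline\Omega\cup\bigcup\overline\Omega_{D,i}$ is Lipschitz. $\mathcal T=\{T\}$ is a simplicial shape-regular triangulation of $\Omega$ (compatible with $\Gamma_D,\Gamma_N$) with set of element faces $\mathcal F=\{F\}$, $h_F$ being the local mesh size at $F$; constants ''independent of the mesh size'' may depend on shape regularity. On $\partial T$, $\mathbf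 n$ is the outer normal, $v_n=\mathbf v\cdot\mathbf n$, $\mathbf v_{\mathbf t}=\mathbf v-v_n\mathbf n$, $\tau_{nn}=(\underline{\boldsymbol\tau}\mathbf n)\cdot\mathbf n$; $\underline{\boldsymbol\varepsilon}(\mathbf v)=\frac12(\nabla\mathbf v+\nabla\mathbf v^T)$. For an integer $k\ge1$: - $\underline{\boldsymbol\Sigma}_h$: symmetric tensor fields in $L^2(\Omega)$ that are polynomial of degree $\le k$ on each $T$, have $\tau_{h,nn}$ continuous across element faces, and $\tau_{h,nn}=0$ on $\Gamma_N$; - $\mathbf V_h$: vector fields in $L^2(\Omega)$ polynomial of degree $\le k$ on each $T$, with $\mathbf v_{h,\mathbf t}$ continuous across element faces and $\mathbf v_{h,\mathbf t}=0$ on $\Gamma_D$; - $W_h$: continuous functions, polynomial of degree $\le k+1$ on each $T$, vanishing on $\Gamma_D$. Bilinear forms: $a(\underline{\boldsymbol\sigma},\underline{\boldsymbol\tau})=\int_\Omega\underline{\mathbf C}^{-1}\underline{\boldsymbol\sigma}:\underline{\boldsymbol\tau}\,dx$ and $b(\underline{\boldsymbol\tau},\mathbf v)=-\sum_{T\in\mathcal T}\big(\int_T\underline{\boldsymbol\tau}:\underline{\boldsymbol\varepsilon}(\mathbf v)\,dx-\int_{\partial T}\tau_{nn}v_n\,ds\big)$. Here $\underline{\mathbf C}$ is the elasticity tensor of linear (Hooke) elasticity determined by Young's modulus $E$ (bounded) and Poisson ratio $\nu$ (bounded away from $1/2$), such that $\underline{\mathbf C}$ and $\underline{\mathbf C}^{-1}$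 exist and lie in $L^\infty(\Omega)$; they are symmetric and uniformly positive definite on symmetric tensors. Discrete norm: $$\|\underline{\boldsymbol\tau}_h\|_{\underline{\boldsymbol\Sigma}_h}^2=\|\underline{\boldsymbol\tau}_h\|_{L^2}^2+\sum_{F\in\mathcal F}h_F\|\tau_{h,nn}\|_{L^2(F)}^2+\Big(\sup_{w_h\in W_h}\frac{b(\underline{\boldsymbol\tau}_h,\nabla w_h)}{\|\nabla w_h\|_{L^2}}\Big)^2.$$ *)

(* Defs.v *)
From HB Require Import structures.
From mathcomp Require Import all_boot all_order all_algebra.
From mathcomp Require Import all_classical all_reals all_analysis.
From mathcomp Require Import -(notations) mpoly.
From mathcomp Require Import ring.

Set Implicit Arguments.
Unset Strict Implicit.
Unset Printing Implicit Defensive.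

Import Order.TTheory GRing.Theory Num.Theory numFieldNormedType.Exports.

Local Open Scope classical_set_scope.
Local Open Scope ring_scope.

(** * Euclidean vector and tensor algebra

    Points and vectors are row vectors ['rV[R]_3].  Their library norm is the
    sup norm; it is only used for the topology, and [enorm] is the Euclidean
    norm. *)

Definition dot (R : realType) (x y : 'rV[R]_3) : R := \sum_(i < 3) x 0 i * y 0 i.

Definition enorm (R : realType) (x : 'rV[R]_3) : R := Num.sqrt (dot x x).

Definition cross (R : realType) (x y : 'rV[R]_3) : 'rV[R]_3 :=
  \row_(j < 3) [:: x 0 1 * y 0 2%:R - x 0 2%:R * y 0 1;
                   x 0 2%:R * y 0 0 - x 0 0 * y 0 2%:R;
                   x 0 0 * y 0 1 - x 0 1 * y 0 0]`_j.

Definition ddot (R : realType) (S T : 'M[R]_3) : R :=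
  \sum_(i < 3) \sum_(j < 3) S i j * T i j.

(* (S n) . n; since vectors are rows, S n is n *m S^T. *)
Definition nn_comp (R : realType) (S : 'M[R]_3) (n : 'rV[R]_3) : R :=
  dot (n *m S^T) n.

Definition tang_comp (R : realType) (v n : 'rV[R]_3) : 'rV[R]_3 :=
  v - dot v n *: n.

Definition diam (R : realType) (A : set 'rV[R]_3) : R :=
  sup [set enorm (x - y) | x in A & y in A].

(* radius of the largest closed Euclidean ball contained in A *)
Definition inradius (R : realType) (A : set 'rV[R]_3) : R :=
  sup [set r : R | 0 <= r /\
    exists x : 'rV[R]_3, forall y, enorm (y - x) <= r -> A y].

(** * Volume integrals and Lebesgue spaces

    The library puts no Borel structure on ['rV[R]_3], so measurability and
    integrals are taken in coordinates, i.e. along [of_coords], for the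
    product Lebesgue measure. *)

Notation leb2 R := (@lebesgue_measure R \x @lebesgue_measure R)%E.
Notation leb3 R :=
  ((@lebesgue_measure R \x @lebesgue_measure R)%E \x @lebesgue_measure R)%E.
Notation coords R :=
  (measurableTypeR R * measurableTypeR R * measurableTypeR R)%type.

Definition of_coords (R : realType) (u : coords R) : 'rV[R]_3 :=
  \row_(j < 3) [:: u.1.1; u.1.2; u.2]`_j.

Definition vol_int (R : realType) (A : set 'rV[R]_3) (f : 'rV[R]_3 -> R) : R :=
  (\int[leb3 R]_(u in @of_coords R @^-1` A) f (of_coords u))%R.

Definition measurable_on (R : realType) (A : set 'rV[R]_3)
    (f : 'rV[R]_3 -> R) : Prop :=
  measurable_fun (@of_coords R @^-1` A) (fun u : coords R => f (of_coords u)).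

Definition ae_on (R : realType) (A : set 'rV[R]_3)
    (P : 'rV[R]_3 -> Prop) : Prop :=
  {ae leb3 R, forall u : coords R, A (of_coords u) -> P (of_coords u)}.

Definition in_Linfty (R : realType) (A : set 'rV[R]_3)
    (f : 'rV[R]_3 -> R) : Prop :=
  measurable_on A f /\ exists K : R, ae_on A (fun x => `|f x| <= K).

Definition in_L2 (R : realType) (A : set 'rV[R]_3)
    (f : 'rV[R]_3 -> R) : Prop :=
  measurable_on A f /\
  (leb3 R).-integrable (@of_coords R @^-1` A)
    (fun u : coords R => (f (of_coords u) ^+ 2)%:E).

(** * Differential operators and polynomials *)

Definition grad (R : realType) (w : 'rV[R]_3 -> R) (x : 'rV[R]_3) : 'rV[R]_3 :=
  \row_(j < 3) 'D_(delta_mx 0 j) w x.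

Definition jacobian (R : realType) (v : 'rV[R]_3 -> 'rV[R]_3)
    (x : 'rV[R]_3) : 'M[R]_3 :=
  \matrix_(i < 3, j < 3) 'D_(delta_mx 0 j) (fun y => v y 0 i) x.

Definition sym_grad (R : realType) (v : 'rV[R]_3 -> 'rV[R]_3)
    (x : 'rV[R]_3) : 'M[R]_3 :=
  2^-1 *: (jacobian v x + (jacobian v x)^T).

(* [msize p] is one plus the total degree of p. *)
Definition polynomial_on (R : realType) (k : nat) (A : set 'rV[R]_3)
    (f : 'rV[R]_3 -> R) : Prop :=
  exists p : mpoly 3 R,
    (msize p <= k.+1)%N /\ forall x, A x -> f x = meval (x 0) p.

(** * The domain and its boundary *)

Definition bdry (R : realType) (A : set 'rV[R]_3) : set 'rV[R]_3 :=
  closure A `\` A°.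

Definition rel_interior (R : realType) (B A : set 'rV[R]_3) : set 'rV[R]_3 :=
  [set x | A x /\ \forall y \near x, B y -> A y].

(* Near each boundary point, in suitable Cartesian coordinates, O is the
   region below the graph of a Lipschitz function. *)
Definition lipschitz_boundary (R : realType) (O : set 'rV[R]_3) : Prop :=
  forall x0, bdry O x0 ->
    exists (Q : 'M[R]_3) (phi : R -> R -> R) (L : R),
      [/\ Q *m Q^T = 1%:M,
          forall s t s' t', `|phi s t - phi s' t'| <= L * (`|s - s'| + `|t - t'|)
        & \forall y \near x0,
            O y <-> ((y - x0) *m Q) 0 2%:R <
                    phi (((y - x0) *m Q) 0 0) (((y - x0) *m Q) 0 1)].

Definition triangle (R : realType) (a b c : 'rV[R]_3) : set 'rV[R]_3 :=
  [set x | exists s t : R,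
    [/\ 0 <= s, 0 <= t, s + t <= 1 & x = a + s *: (b - a) + t *: (c - a)]].

Definition polygon (R : realType) (P : set 'rV[R]_3) : Prop :=
  [/\ connected P,
      exists (n : 'rV[R]_3) (d : R), n != 0 /\ forall x, P x -> dot n x = d
    & exists ts : seq ('rV[R]_3 * 'rV[R]_3 * 'rV[R]_3),
      [/\ ts != [::],
          forall t, t \in ts -> cross (t.1.2 - t.1.1) (t.2 - t.1.1) != 0
        & P = [set x | exists2 t, t \in ts & triangle t.1.1 t.1.2 t.2 x]]].

(* The polygons [f i] tile the boundary of Omega without overlap. *)
Definition boundary_faces (R : realType) (Omega : set 'rV[R]_3) (m : nat)
    (f : 'I_m -> set 'rV[R]_3) : Prop :=
  [/\ forall i, polygon (f i),
      bdry Omega = \bigcup_(i in [set: 'I_m]) f i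
    & forall i j, i != j -> rel_interior (bdry Omega) (f i `&` f j) = set0].

Definition is_component (R : realType) (A C : set 'rV[R]_3) : Prop :=
  exists2 x, A x & C = connected_component A x.

(* [OD C] is the exterior Lipschitz domain attached to Omega along the
   connected component C of GammaD. *)
Definition dirichlet_extension (R : realType) (Omega GammaD : set 'rV[R]_3)
    (OD : set 'rV[R]_3 -> set 'rV[R]_3) : Prop :=
  [/\ forall C, is_component GammaD C ->
        [/\ open (OD C), connected (OD C), lipschitz_boundary (OD C),
            closure (OD C) `&` closure Omega = C & OD C `&` Omega = set0],
      forall C C', is_component GammaD C -> is_component GammaD C' -> C <> C' ->
        exists2 d : R, 0 < d &
          forall x y, OD C x -> OD C' y -> d <= enorm (x - y)
    & lipschitz_boundary
        (closure Omega `|`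
           \bigcup_(C in [set C | is_component GammaD C]) closure (OD C))°].

Record domain_setting (R : realType) (Omega GammaD GammaN : set 'rV[R]_3) :
    Prop := DomainSetting {
  dom_open : open Omega;
  dom_nonempty : Omega !=set0;
  dom_bounded : bounded_set Omega;
  dom_connected : connected Omega;
  dom_lipschitz : lipschitz_boundary Omega;
  dom_polyhedral : exists (m : nat) (f : 'I_m -> set 'rV[R]_3),
    [/\ boundary_faces Omega f,
        exists ID : {set 'I_m}, GammaD = \bigcup_(i in [set i | i \in ID]) f i
      & exists IN : {set 'I_m}, GammaN = \bigcup_(i in [set i | i \in IN]) f i];
  dom_closedD : closed GammaD;
  dom_closedN : closed GammaN;
  dom_nontrivialD : GammaD !=set0;
  dom_GammaN : GammaN = bdry Omega `\` rel_interior (bdry Omega) GammaD;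
  dom_extension : exists OD, dirichlet_extension Omega GammaD OD }.

(** * Elasticity tensor

    A fourth-order tensor is a 9 x 9 matrix acting on row-vectorized 3 x 3
    matrices, so that its inverse is [invmx]. *)

Definition tensor_app (R : realType) (C : 'M[R]_(3 * 3)) (S : 'M[R]_3) :
  'M[R]_3 := vec_mx (mxvec S *m C).

(* 2 mu S + lambda tr(S) I, with the Lame parameters
   mu = E / (2 (1 + nu)) and lambda = E nu / ((1 + nu) (1 - 2 nu)). *)
Definition hooke_law (R : realType) (E nu : R) (S : 'M[R]_3) : 'M[R]_3 :=
  (E / (1 + nu)) *: S + (E * nu / ((1 + nu) * (1 - 2 * nu)) * \tr S)%:M.

Definition hooke (R : realType) (E nu : R) : 'M[R]_(3 * 3) :=
  lin_mx (hooke_law E nu).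

Lemma hookeE (R : realType) (E nu : R) (S : 'M[R]_3) :
  tensor_app (hooke E nu) S = hooke_law E nu S.
Proof.
have lin : linear (hooke_law E nu).
  move=> a A B; apply/matrixP => i j.
  rewrite /hooke_law mxtraceD mxtraceZ !mxE.
  by case: (i == j); rewrite ?mulr1n ?mulr0n; ring.
pose fA := GRing.isLinear.Build R 'M[R]_3 'M[R]_3 *:%R (hooke_law E nu) lin.
pose f : {linear 'M[R]_3 -> 'M[R]_3} := HB.pack (hooke_law E nu) fA.
rewrite /tensor_app /hooke.
have H := @mul_vec_lin R 3 3 3 3 f S.
transitivity (vec_mx (mxvec (f S))); last by rewrite mxvecK.
congr vec_mx; exact: H.
Qed.

Definition tensor_symmetric (R : realType) (C : 'M[R]_(3 * 3)) : Prop :=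
  forall S T : 'M[R]_3, S^T = S -> T^T = T ->
    ddot (tensor_app C S) T = ddot S (tensor_app C T).

Definition tensor_coercive (R : realType) (alpha : R) (C : 'M[R]_(3 * 3)) :
    Prop :=
  forall S : 'M[R]_3, S^T = S -> alpha * ddot S S <= ddot (tensor_app C S) S.

Definition uniformly_spd (R : realType) (Omega : set 'rV[R]_3)
    (C : 'rV[R]_3 -> 'M[R]_(3 * 3)) : Prop :=
  ae_on Omega (fun x => tensor_symmetric (C x)) /\
  exists2 alpha : R, 0 < alpha &
    ae_on Omega (fun x => tensor_coercive alpha (C x)).

Record elastic_material (R : realType) (Omega : set 'rV[R]_3)
    (E nu : 'rV[R]_3 -> R) : Prop := ElasticMaterial {
  mat_E_bounded : exists K : R, ae_on Omega (fun x => `|E x| <= K);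
  mat_nu_lt_half : exists2 d : R, 0 < d &
    ae_on Omega (fun x => nu x <= 2^-1 - d);
  mat_invertible : ae_on Omega (fun x => hooke (E x) (nu x) \in unitmx);
  mat_C_Linfty : forall i j, in_Linfty Omega (fun x => hooke (E x) (nu x) i j);
  mat_Cinv_Linfty : forall i j,
    in_Linfty Omega (fun x => invmx (hooke (E x) (nu x)) i j);
  mat_C_spd : uniformly_spd Omega (fun x => hooke (E x) (nu x));
  mat_Cinv_spd : uniformly_spd Omega (fun x => invmx (hooke (E x) (nu x))) }.

(** * Simplicial triangulations

    A mesh is given by its vertices and by its elements, an element being
    the set of (the indices of) its four vertices. *)

Record mesh (R : realType) := Mesh {
  nvtx : nat;
  vtx : 'I_nvtx -> 'rV[R]_3;
  elts : {set {set 'I_nvtx}} }.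

Definition hull (R : realType) (M : mesh R) (A : {set 'I_(nvtx M)}) :
    set 'rV[R]_3 :=
  [set x | exists l : 'I_(nvtx M) -> R,
    [/\ forall i, 0 <= l i, forall i, i \notin A -> l i = 0,
        \sum_i l i = 1 & x = \sum_i l i *: vtx i]].

(* the open element spanned by T *)
Definition elem (R : realType) (M : mesh R) (T : {set 'I_(nvtx M)}) :
    set 'rV[R]_3 := (hull T)°.

Definition is_face (R : realType) (M : mesh R) (F : {set 'I_(nvtx M)}) : bool :=
  (#|F| == 3%N) && [exists T in elts M, F \subset T].

Definition aff_indep (R : realType) (M : mesh R) (A : {set 'I_(nvtx M)}) :
    Prop :=
  forall l : 'I_(nvtx M) -> R,
    \sum_(i in A) l i = 0 -> \sum_(i in A) l i *: vtx i = 0 ->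
    forall i, i \in A -> l i = 0.

Definition union_of_faces (R : realType) (M : mesh R) (G : set 'rV[R]_3) :
    Prop :=
  exists S : {set {set 'I_(nvtx M)}},
    (forall F, F \in S -> is_face F) /\
    G = \bigcup_(F in [set F | F \in S]) hull F.

Record triangulation (R : realType) (Omega GammaD GammaN : set 'rV[R]_3)
    (M : mesh R) : Prop := Triangulation {
  tri_vtx_inj : injective (@vtx R M);
  tri_card : forall T, T \in elts M -> #|T| = 4%N;
  tri_nondeg : forall T, T \in elts M -> aff_indep T;
  tri_conform : forall T T', T \in elts M -> T' \in elts M ->
    hull T `&` hull T' = hull (T :&: T');
  tri_cover : closure Omega = \bigcup_(T in [set T | T \in elts M]) hull T;
  tri_compatD : union_of_faces M GammaD;
  tri_compatN : union_of_faces M GammaN }.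

Definition shape_regular (R : realType) (gamma : R) (M : mesh R) : Prop :=
  forall T, T \in elts M -> diam (hull T) <= gamma * (2 * inradius (hull T)).

(** * Faces: parametrization, normals, surface integrals *)

Definition fvtx (R : realType) (M : mesh R) (F : {set 'I_(nvtx M)})
    (n : nat) : 'rV[R]_3 := [seq vtx i | i <- enum F]`_n.

Definition fcross (R : realType) (M : mesh R) (F : {set 'I_(nvtx M)}) :
    'rV[R]_3 := cross (fvtx F 1 - fvtx F 0) (fvtx F 2 - fvtx F 0).

(* surface integral over F, through its affine parametrization by the unit
   triangle, whose area element is [enorm (fcross F)] *)
Definition face_int (R : realType) (M : mesh R) (F : {set 'I_(nvtx M)})
    (f : 'rV[R]_3 -> R) : R :=
  enorm (fcross F) *
  (\int[leb2 R]_(u in [set u : measurableTypeR R * measurableTypeR R |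
                        [/\ 0 <= u.1, 0 <= u.2 & u.1 + u.2 <= 1]])
     f (fvtx F 0 + u.1 *: (fvtx F 1 - fvtx F 0)
                 + u.2 *: (fvtx F 2 - fvtx F 0)))%R.

Definition fnormal (R : realType) (M : mesh R) (F : {set 'I_(nvtx M)}) :
    'rV[R]_3 := (enorm (fcross F))^-1 *: fcross F.

Definition centroid (R : realType) (M : mesh R) (T : {set 'I_(nvtx M)}) :
    'rV[R]_3 := #|T|%:R^-1 *: \sum_(i in T) vtx i.

(* unit normal of the face F pointing out of T *)
Definition outer_normal (R : realType) (M : mesh R) (T F : {set 'I_(nvtx M)}) :
    'rV[R]_3 :=
  Num.sg (dot (fnormal F) (fvtx F 0 - centroid T)) *: fnormal F.

Definition mesh_size (R : realType) (M : mesh R) (F : {set 'I_(nvtx M)}) : R :=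
  diam (hull F).

(** * Traces

    The trace of a piecewise smooth field on the boundary of T is its limit
    from inside T. *)

Definition trace (R : realType) (M : mesh R) (T : {set 'I_(nvtx M)}) (m n : nat)
    (f : 'rV[R]_3 -> 'M[R]_(m, n)) (x : 'rV[R]_3) : 'M[R]_(m, n) :=
  \matrix_(i < m, j < n)
    lim ((fun y => f y i j) @ within (elem T) (nbhs x)).

(* The sign of the normal is irrelevant for [nn_comp] and [tang_comp]. *)
Definition nn_trace (R : realType) (M : mesh R) (T F : {set 'I_(nvtx M)})
    (tau : 'rV[R]_3 -> 'M[R]_3) (x : 'rV[R]_3) : R :=
  nn_comp (trace T tau x) (fnormal F).

Definition tang_trace (R : realType) (M : mesh R) (T F : {set 'I_(nvtx M)})
    (v : 'rV[R]_3 -> 'rV[R]_3) (x : 'rV[R]_3) : 'rV[R]_3 :=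
  tang_comp (trace T v x) (fnormal F).

(** * Finite element spaces

    Fields are functions on ['rV[R]_3].  Polynomiality and traces only involve
    the open elements, so the values on the mesh skeleton, a null set, are
    irrelevant. *)

Record Sigma_h (R : realType) (Omega GammaN : set 'rV[R]_3) (k : nat)
    (M : mesh R) (tau : 'rV[R]_3 -> 'M[R]_3) : Prop := SigmaH {
  Sigma_sym : forall x, Omega x -> (tau x)^T = tau x;
  Sigma_L2 : forall i j, in_L2 Omega (fun x => tau x i j);
  Sigma_poly : forall T, T \in elts M ->
    forall i j, polynomial_on k (elem T) (fun x => tau x i j);
  Sigma_cont : forall T T' F : {set 'I_(nvtx M)},
    T \in elts M -> T' \in elts M -> is_face F -> F \subset T -> F \subset T' ->
    forall x, hull F x -> nn_trace T F tau x = nn_trace T' F tau x;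
  Sigma_bc : forall T F : {set 'I_(nvtx M)},
    T \in elts M -> is_face F -> F \subset T -> hull F `<=` GammaN ->
    forall x, hull F x -> nn_trace T F tau x = 0 }.

Record V_h (R : realType) (Omega GammaD : set 'rV[R]_3) (k : nat)
    (M : mesh R) (v : 'rV[R]_3 -> 'rV[R]_3) : Prop := VH {
  V_L2 : forall i, in_L2 Omega (fun x => v x 0 i);
  V_poly : forall T, T \in elts M ->
    forall i, polynomial_on k (elem T) (fun x => v x 0 i);
  V_cont : forall T T' F : {set 'I_(nvtx M)},
    T \in elts M -> T' \in elts M -> is_face F -> F \subset T -> F \subset T' ->
    forall x, hull F x -> tang_trace T F v x = tang_trace T' F v x;
  V_bc : forall T F : {set 'I_(nvtx M)},
    T \in elts M -> is_face F -> F \subset T -> hull F `<=` GammaD ->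
    forall x, hull F x -> tang_trace T F v x = 0 }.

Record W_h (R : realType) (Omega GammaD : set 'rV[R]_3) (k : nat)
    (M : mesh R) (w : 'rV[R]_3 -> R) : Prop := WH {
  W_cont : {within closure Omega, continuous w};
  W_poly : forall T, T \in elts M -> polynomial_on k.+1 (elem T) w;
  W_bc : forall x, GammaD x -> w x = 0 }.

(** * Bilinear forms, discrete kernel, discrete norm *)

Definition form_a (R : realType) (Omega : set 'rV[R]_3) (E nu : 'rV[R]_3 -> R)
    (sigma tau : 'rV[R]_3 -> 'M[R]_3) : R :=
  vol_int Omega (fun x =>
    ddot (tensor_app (invmx (hooke (E x) (nu x))) (sigma x)) (tau x)).

Definition form_b (R : realType) (M : mesh R)
    (tau : 'rV[R]_3 -> 'M[R]_3) (v : 'rV[R]_3 -> 'rV[R]_3) : R :=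
  - \sum_(T in elts M)
      (vol_int (elem T) (fun x => ddot (tau x) (sym_grad v x)) -
       \sum_(F : {set 'I_(nvtx M)} | is_face F && (F \subset T))
         face_int F (fun x => nn_comp (trace T tau x) (outer_normal T F) *
                              dot (trace T v x) (outer_normal T F))).

Definition Ker_B (R : realType) (Omega GammaD GammaN : set 'rV[R]_3) (k : nat)
    (M : mesh R) (tau : 'rV[R]_3 -> 'M[R]_3) : Prop :=
  Sigma_h Omega GammaN k M tau /\
  forall v, V_h Omega GammaD k M v -> form_b M tau v = 0.

(* ||grad w|| in L^2(Omega) *)
Definition grad_norm (R : realType) (Omega : set 'rV[R]_3)
    (w : 'rV[R]_3 -> R) : R :=
  Num.sqrt (vol_int Omega (fun x => dot (grad w x) (grad w x))).

(* The supremum is over a bounded set, W_h being finite-dimensional; it is 0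
   when W_h is trivial, by the convention [sup set0 = 0]. *)
Definition b_sup (R : realType) (Omega GammaD : set 'rV[R]_3) (k : nat)
    (M : mesh R) (tau : 'rV[R]_3 -> 'M[R]_3) : R :=
  sup [set form_b M tau (grad w) / grad_norm Omega w |
        w in [set w | W_h Omega GammaD k M w /\ 0 < grad_norm Omega w]].

(* some element having F as a face *)
Definition face_elt (R : realType) (M : mesh R) (F : {set 'I_(nvtx M)}) :
    {set 'I_(nvtx M)} :=
  odflt finset.set0 [pick T in elts M | F \subset T].

(* On Sigma_h the trace [nn_trace] is the same from both sides of a face, so
   that the choice made by [face_elt] does not matter. *)
Definition Sigma_norm (R : realType) (Omega GammaD : set 'rV[R]_3) (k : nat)
    (M : mesh R) (tau : 'rV[R]_3 -> 'M[R]_3) : R :=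
  Num.sqrt (
    vol_int Omega (fun x => ddot (tau x) (tau x)) +
    \sum_(F : {set 'I_(nvtx M)} | is_face F)
      mesh_size F * face_int F (fun x => nn_trace (face_elt F) F tau x ^+ 2) +
    b_sup Omega GammaD k M tau ^+ 2).

(* Main.v *)
(* On the kernel, b(tau, grad w) = 0 for every w in W_h, because grad w belongs
   to V_h: it is piecewise polynomial of degree k, and on a face its tangential
   part is the surface gradient of the common trace of w. So the supremum in the
   norm of Sigma_h vanishes. The face terms are controlled by the L^2 norm
   through a discrete trace inequality. A shape-regular tetrahedron T of
   diameter h contains an axis-parallel cube of side comparable to h, so that
   iterating a one-dimensional estimate in the three coordinate directions
   bounds h^3 p(x)^2, for x in T and p of degree k, by the integral of p^2 over
   that cube; no change of variables to a reference element is needed. Finally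
   the form a dominates the L^2 norm since C^-1 is uniformly positive
   definite. *)

From HB Require Import structures.
Require Import Defs.
From mathcomp Require Import all_boot all_order all_algebra.
From mathcomp Require Import all_classical all_reals all_analysis measurable_realfun.
From mathcomp Require Import -(notations) mpoly.
From mathcomp Require Import ring lra zify.

Set Implicit Arguments.
Unset Strict Implicit.
Unset Printing Implicit Defensive.

Import Order.TTheory GRing.Theory Num.Theory numFieldNormedType.Exports.
Local Open Scope classical_set_scope.
Local Open Scope ring_scope.

(** * Polynomials of one variable *)

(** The powers of the mesh size cancel by direct counting. Put m = 8 |gamma|; the cube inside T has
    side s with diam T <= m s. The weight h_F and the area element of F together cost at most (m
    s)^3, while a squared trace value costs a constant times s^-3 times the energy of T, so what
    remains depends on gamma and k only. Two obstacles shape the rest. First, a triangulation covers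
    the closure of Omega, whereas the energy is integrated over Omega: that open elements lie in
    Omega comes from the Lipschitz boundary, which forbids slits. Secondly, membership in [V_h]
    includes square integrability of the field itself, while [grad w] is uncontrolled on the
    skeleton; a modified gradient is tested instead, and the form b cannot tell the two apart, since
    it only sees the fields inside the open elements. *)

Lemma horner_lagrange (K : fieldType) (n : nat) (t : 'I_n -> K) (p : {poly K})
    (x : K) :
  injective t -> (size p <= n)%N ->
  p.[x] = \sum_j p.[t j] * \prod_(i | i != j) ((x - t i) / (t j - t i)).
Proof.
move=> tI sp.
pose L j := (\prod_(i | i != j) (t j - t i)^-1) *:
            \prod_(i | i != j) ('X - (t i)%:P).
have LE j y : (L j).[y] = \prod_(i | i != j) ((y - t i) / (t j - t i)).
  rewrite hornerZ horner_prod mulrC -big_split /=; apply: eq_bigr => i _.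
  by rewrite hornerXsubC.
have Lt i j : (L j).[t i] = (i == j)%:R.
  rewrite LE; have [->|ij] := eqVneq i j.
    apply: big1 => l lj; rewrite divff // subr_eq0.
    by apply: contra lj => /eqP/tI ->.
  by rewrite (bigD1 i) //= subrr mul0r mul0r.
have sL j : (size (L j) <= n)%N.
  apply: leq_trans (size_scale_leq _ _) _.
  rewrite size_prod => [|i _]; last by rewrite polyXsubC_eq0.
  under eq_bigr do rewrite size_XsubC.
  rewrite sum_nat_const cardC1 card_ord muln2 -addnn subSn ?leq_addr// addnK.
  by rewrite prednK // (leq_ltn_trans _ (ltn_ord j)).
pose q := p - \sum_j (p.[t j])%:P * L j.
(* The size of [q] is at most n, yet the n distinct nodes are all roots of it. *)
have q0 : q = 0.
  apply/eqP; apply: contraT => qn0.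
  have := max_poly_roots qn0 (_ : all (root q) [seq t i | i <- enum 'I_n]).
  rewrite map_inj_uniq // enum_uniq size_map size_enum_ord.
  have sq : (size q <= n)%N.
    apply: leq_trans (size_polyD _ _) _; rewrite geq_max sp size_polyN.
    apply: leq_trans (size_sum _ _ _) _; apply/bigmax_leqP => j _.
    by rewrite mul_polyC (leq_trans (size_scale_leq _ _)).
  move=> /(_ _ isT) H; rewrite ltnNge sq in H; apply: H.
  apply/allP => _ /mapP [i _ ->]; rewrite rootE hornerD hornerN horner_sum.
  rewrite (bigD1 i) //= hornerM hornerC Lt eqxx mulr1 big1 ?addr0 ?subrr //.
  by move=> j ji; rewrite hornerM Lt eq_sym (negPf ji) mulr0.
rewrite -[p in LHS](subrK (\sum_j (p.[t j])%:P * L j)) -/q q0 add0r horner_sum.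
by apply: eq_bigr => j _; rewrite hornerM hornerC LE.
Qed.

(** Each of the k+1 Lagrange basis polynomials is a product of k factors, each at most D / d in
    absolute value. *)
Lemma horner_lagrange_le (K : realFieldType) (k : nat) (t : 'I_k.+1 -> K)
    (p : {poly K}) (d D m x : K) :
  0 < d -> (forall i j, i != j -> d <= `|t j - t i|) ->
  (forall j, `|x - t j| <= D) -> (size p <= k.+1)%N ->
  (forall j, `|p.[t j]| <= m) ->
  `|p.[x]| <= k.+1%:R * (m * (D / d) ^+ k).
Proof.
move=> d0 td tD sp pm.
have tI : injective t.
  move=> i j tij; apply/eqP; apply: contraT => ij.
  by have := td _ _ ij; rewrite tij subrr normr0 leNgt d0.
rewrite (horner_lagrange x tI sp); apply: le_trans (ler_norm_sum _ _ _) _.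
apply: le_trans (_ : \sum_(j < k.+1) m * (D / d) ^+ k <= _); last first.
  by rewrite sumr_const card_ord mulr_natl.
apply: ler_sum => j _; rewrite normrM ler_pM // normr_prod.
have -> : (D / d) ^+ k = \prod_(i < k.+1 | i != j) (D / d).
  by rewrite prodr_const cardC1 card_ord.
apply: ler_prod => i ij; rewrite normr_ge0 /= normrM normfV ler_pM ?tD ?invr_ge0 ?normr_ge0 //.
rewrite lef_pV2 ?posrE //; first exact: td.
by apply: lt_le_trans d0 _; exact: td.
Qed.

(** The integral of a nonnegative function is a supremum over the simple functions below it;
    enlarging the set or the integrand only enlarges that family. *)
Lemma ge0_le_integral_set (d : measure_display) (T : measurableType d)
    (R : realType) (mu : {measure set T -> \bar R}) (A B : set T)
    (f g : T -> \bar R) :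
  (forall x, A x -> 0 <= f x)%E -> (forall x, B x -> 0 <= g x)%E ->
  A `<=` B -> (forall x, A x -> f x <= g x)%E ->
  (\int[mu]_(x in A) f x <= \int[mu]_(x in B) g x)%E.
Proof.
move=> f0 g0 AB fg.
rewrite !ge0_integralE // /=; apply: ereal_sup_le.
move=> _ [h hf <-]; exists h => // x; apply: le_trans (hf x) _.
rewrite !patchE; case: ifPn => [xA|_].
  by rewrite mem_set ?fg //; [exact: set_mem|apply: AB; exact: set_mem].
by case: ifPn => // xB; apply: g0; exact: set_mem.
Qed.

(** The nodes are separated by l = s / (2k+1) and lie within (M+1) s of the point, so (M+1)(2k+1) is
    the ratio D / d of the interpolation bound. The last factor is s / l, from taking means over
    subintervals of length l. *)
Definition inverse_const (R : realType) (k : nat) (M : R) : R :=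
  (k.+1%:R * ((M + 1) * (2 * k + 1)%:R) ^+ k) ^+ 2 * (2 * k + 1)%:R.

Lemma inverse_const_ge0 (R : realType) (k : nat) (M : R) :
  0 <= inverse_const k M.
Proof. by rewrite mulr_ge0 // sqr_ge0. Qed.

(* Lagrange interpolation at the minimizers of p^2 on every other one of
   2k+1 equal subintervals: these nodes are separated, and p^2 at a node is at
   most its mean over the subinterval. *)
Lemma inverse_estimate_1d (R : realType) (k : nat) (M a s x : R) (p : {poly R}) :
  0 < s -> 0 <= M -> (size p <= k.+1)%N ->
  a - M * s <= x <= a + s + M * s ->
  ((s * p.[x] ^+ 2)%:E <= (inverse_const k M)%:E *
     \int[@lebesgue_measure R]_(t in [set` `[a, (a + s)%R]]) (p.[t] ^+ 2)%:E)%E.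
Proof.
move=> s0 M0 sp /andP[ax xa].
set I := (\int[_]_(t in _) _)%E.
have N0 : 0 < (2 * k + 1)%:R :> R by rewrite ltr0n addn1.
have C0 : 0 < inverse_const k M.
  rewrite /inverse_const mulr_gt0 // exprn_gt0 // mulr_gt0 ?ltr0n //.
  by rewrite exprn_gt0 // mulr_gt0 // ltr_wpDl.
have I0 : (0 <= I)%E by apply: integral_ge0 => t _; rewrite lee_fin sqr_ge0.
set N := (2 * k + 1)%:R in N0; set l := s / N.
have l0 : 0 < l by rewrite divr_gt0.
have ls : l * N = s by rewrite divfK // gt_eqF.
pose b (j : 'I_k.+1) := a + (2 * j)%:R * l.
have /choice[t tP] (j : 'I_k.+1) : exists t, [/\ b j <= t, t <= b j + l &
    (forall y, b j <= y <= b j + l -> p.[t] ^+ 2 <= p.[y] ^+ 2)].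
  have cp : {within `[b j, b j + l], continuous (horner (p ^+ 2))}.
    by apply: continuous_subspaceT => ?; exact: continuous_horner.
  have [|t] := EVT_min _ cp; first by rewrite lerDl ltW.
  rewrite in_itv /= => /andP[bt tb] tmin; exists t; split => // y yb.
  by have := tmin y; rewrite !horner_exp in_itv /=; exact.
have bl (j : 'I_k.+1) : b j + l <= a + s.
  rewrite /b -addrA lerD2l -[X in _ + X]mul1r -mulrDl -ls [leRHS]mulrC.
  rewrite ler_pM2r // natr1 ler_nat addn1 ltnS leq_mul2l /=.
  by rewrite -ltnS ltn_ord.
have tI j : ((l * p.[t j] ^+ 2)%:E <= I)%E.
  have -> : (l * p.[t j] ^+ 2)%:E = (\int[@lebesgue_measure R]_(y in
      [set` `[b j, (b j + l)%R]]) cst (p.[t j] ^+ 2)%:E y)%E.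
    rewrite integral_cst //= lebesgue_measure_itv /= lte_fin ltrDl l0.
    by rewrite -EFinD -EFinM addrAC subrr add0r mulrC.
  apply: ge0_le_integral_set => [y _|y _|y|y] /=.
  - by rewrite lee_fin sqr_ge0.
  - by rewrite lee_fin sqr_ge0.
  - rewrite !in_itv /= => /andP[by1 by2]; rewrite (le_trans by2 (bl j)) andbT.
    by apply: le_trans by1; rewrite lerDl mulr_ge0 // ltW.
  - by rewrite in_itv /= lee_fin => yb; have [_ _] := tP j; apply.
(* The integral stays an extended real: the value +oo is harmless because the constant in front is
   positive. *)
clearbody I; case: I I0 tI => [I|_ _|]; last by rewrite leeNy_eq.
  rewrite lee_fin => I0 tI.
  rewrite lee_fin.
  have tm j : `|p.[t j]| <= Num.sqrt (I / l).
    rewrite -sqrtr_sqr ler_sqrt ?(divr_ge0 I0 (ltW l0))//.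
    by rewrite ler_pdivlMr // mulrC -lee_fin.
  have tlt : forall i j : 'I_k.+1, (i < j)%N -> l <= `|t j - t i|.
    move=> i j ij.
    have [tj _ _] := tP j; have [_ ti _] := tP i.
    apply: le_trans (ler_norm _).
    have : (2 * i + 2)%:R * l <= (2 * j)%:R * l.
      by rewrite ler_pM2r // ler_nat -mulnSr leq_mul2l.
    rewrite /b in tj ti; rewrite natrD mulrDl; lra.
  have td : forall i j : 'I_k.+1, i != j -> l <= `|t j - t i|.
    move=> i j; rewrite neq_ltn => /orP[/tlt //|/tlt]; by rewrite distrC.
  have tD j : `|x - t j| <= (M + 1) * s.
    have [tj1 tj2 _] := tP j; have bj := bl j.
    have ab : a <= b j by rewrite lerDl mulr_ge0 // ltW.
    rewrite ler_norml; apply/andP; split; lra.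
  have := horner_lagrange_le l0 td tD sp tm.
  have -> : (M + 1) * s / l = (M + 1) * N.
    by rewrite -ls -mulrA; congr (_ * _); rewrite mulrAC divff ?mul1r // gt_eqF.
  rewrite mulrCA => H.
  have {}H : p.[x] ^+ 2 <= (k.+1%:R * ((M + 1) * N) ^+ k) ^+ 2 * (I / l).
    rewrite -(sqr_sqrtr (_ : 0 <= I / l)) ?(divr_ge0 I0 (ltW l0))//.
    rewrite -exprMn -(real_normK (num_real p.[x])).
    have H2 := le_trans H (_ : _ <= k.+1%:R * ((M + 1) * N) ^+ k * Num.sqrt (I / l)).
    have {}H2 := H2 ltac:(by rewrite mulrC).
    by rewrite lerXn2r ?nnegrE // (le_trans _ H2).
  apply: le_trans (ler_wpM2l (ltW s0) H) _.
  rewrite /inverse_const -/N -ls.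
  rewrite [leLHS](_ : _ = (k.+1%:R * ((M + 1) * N) ^+ k) ^+ 2 * N * I) //.
  by field; rewrite gt_eqF.
by rewrite gt0_muley ?lte_fin // leey.
Qed.

(** * Polynomials of several variables *)

(** Continuity, measurability, differentiability and boundedness on balls all pass through sums and
    products, so this induction serves each of them. *)
Lemma mpoly_ring_ind (n : nat) (R : nzRingType) (Q : mpoly n R -> Prop) :
  (forall c, Q (mpolyC n c)) -> (forall i, Q (mpolyX R (mnm1 i))) ->
  (forall p q, Q p -> Q q -> Q (p + q)) ->
  (forall p q, Q p -> Q q -> Q (p * q)) -> forall p, Q p.
Proof.
move=> QC QX QD QM; elim/mpolyind => [|c m p _ _ Qp].
  by rewrite -mpolyC0.
apply: QD => //; rewrite -mul_mpolyC; apply: (QM) => //.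
rewrite mpolyXE_id; apply: big_rec => [|i q _ Qq].
  by rewrite -mpolyC1.
apply: (QM) => //; elim: (m i) => [|e Qe]; first by rewrite expr0 -mpolyC1.
by rewrite exprS; exact: QM.
Qed.

Lemma size_prod_leqS (R : nzRingType) (I : finType) (F : I -> {poly R})
    (e : I -> nat) :
  (forall i, size (F i) <= (e i).+1)%N ->
  (size (\prod_i F i)%R <= (\sum_i e i).+1)%N.
Proof.
move=> sF; elim/big_rec2: _ => [|i d p _ sp]; first by rewrite size_poly1.
have := leq_trans (size_polyMleq (F i) p) (_ : (_ <= (e i + d).+1)%N).
by apply; have := sF i; lia.
Qed.

(** On a line, a monomial of total degree d becomes a product of d affine polynomials in the
    parameter. Both the coordinate lines of the inverse estimate and the segments inside a face are
    treated this way. *)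
Lemma meval_line (n k : nat) (R : comNzRingType) (p : mpoly n R)
    (a d : 'I_n -> R) :
  (msize p <= k.+1)%N ->
  exists2 q : {poly R}, (size q <= k.+1)%N &
    forall t, meval (fun i => a i + t * d i) p = q.[t].
Proof.
move=> sp.
pose q := \sum_(m <- msupp p)
  (mcoeff m p)%:P * \prod_i (d i *: 'X + (a i)%:P) ^+ m i.
exists q => [|t].
  rewrite /q big_seq; elim/big_rec: _ => [|m r mp sr]; first by rewrite size_poly0.
  apply: leq_trans (size_polyD _ _) _; rewrite geq_max sr andbT mul_polyC.
  apply: leq_trans (size_scale_leq _ _) _.
  apply: leq_trans (_ : (mdeg m).+1 <= _)%N; last first.
    exact: leq_trans (msize_mdeg_lt mp) sp.
  rewrite mdegE; apply: size_prod_leqS => i.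
  apply: leq_trans (size_poly_exp_leq _ _) _; rewrite ltnS.
  rewrite -[leqRHS]mul1n leq_mul2r; apply/orP; right; rewrite -subn1 leq_subLR.
  apply: leq_trans (size_polyD _ _) _; rewrite geq_max.
  rewrite (leq_trans (size_scale_leq _ _)) ?size_polyX //=.
  by rewrite (leq_trans (size_polyC_leq1 _)).
rewrite mevalE /q horner_sum; apply: eq_bigr => m _.
rewrite hornerM hornerC horner_prod; congr (_ * _); apply: eq_bigr => i _.
by rewrite horner_exp hornerD hornerZ hornerX hornerC addrC mulrC.
Qed.

Lemma msize_mderiv (n k : nat) (R : nzRingType) (i : 'I_n) (p : mpoly n R) :
  (msize p <= k.+1)%N -> (msize (mderiv i p) <= k)%N.
Proof.
move=> sp; rewrite msizeE big_seq; apply: (big_ind (fun x => x <= k)%N) => //.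
  by move=> x y xk yk; rewrite geq_max xk.
move=> m; rewrite mcoeff_msupp mcoeff_deriv => H.
have mp : mnm_add m (mnm1 i) \in msupp p.
  by rewrite mcoeff_msupp; apply: contraNneq H => ->; rewrite mul0rn.
by have := leq_trans (msize_mdeg_lt mp) sp; rewrite mdegD mdeg1 addn1 ltnS.
Qed.

Lemma continuous_meval (R : realType) (p : mpoly 3 R) :
  continuous (fun x : 'rV[R]_3 => meval (x 0) p).
Proof.
elim/mpoly_ring_ind: p => [c|i|p q cp cq|p q cp cq].
- under eq_fun do rewrite mevalC; exact: cst_continuous.
- by under eq_fun do rewrite mevalXU; exact: coord_continuous.
- by under eq_fun do rewrite mevalD; move=> x; exact: continuousD (cp x) (cq x).
- by under eq_fun do rewrite mevalM; move=> x; exact: continuousM (cp x) (cq x).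
Qed.

Lemma measurable_meval (R : realType) (p : mpoly 3 R) (A : set (coords R)) :
  measurable_fun A (fun u : coords R => meval (of_coords u 0) p).
Proof.
apply: measurable_funTS.
elim/mpoly_ring_ind: p => [c|i|p q cp cq|p q cp cq].
- by under eq_fun do rewrite mevalC; exact: measurable_cst.
- under eq_fun do rewrite mevalXU mxE.
  case: i => [[|[|[|i]]] //= _].
  + exact: measurableT_comp measurable_fst measurable_fst.
  + exact: measurableT_comp measurable_snd measurable_fst.
  + exact: measurable_snd.
- by under eq_fun do rewrite mevalD; exact: measurable_funD.
- by under eq_fun do rewrite mevalM; exact: measurable_funM.
Qed.

Lemma is_derive_coord (R : realType) (i : 'I_3) (x v : 'rV[R]_3) :
  is_derive x v (fun y : 'rV[R]_3 => y 0 i) (v 0 i).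
Proof.
have H : (fun h => h^-1 *: (((fun y : 'rV[R]_3 => y 0 i) \o shift x) (h *: v) - x 0 i)) @ 0^'
    --> v 0 i.
  apply: cvg_near_cst; near=> h.
  have h0 : h != 0 by near: h; exact: nbhs_dnbhs_neq.
  by rewrite /= !mxE addrK /GRing.scale /= mulKf.
apply: DeriveDef; first by apply/cvg_ex; exists (v 0 i).
exact: cvg_lim H.
Unshelve. all: by end_near. Qed.

Lemma is_derive_meval (R : realType) (p : mpoly 3 R) (x v : 'rV[R]_3) :
  is_derive x v (fun y : 'rV[R]_3 => meval (y 0) p)
    (\sum_i v 0 i * meval (x 0) (mderiv i p)).
Proof.
elim/mpoly_ring_ind: p => [c|i|p q cp cq|p q cp cq].
- under eq_fun do rewrite mevalC.
  apply: is_derive_eq.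
  by rewrite big1 // => i _; rewrite mderivC meval0 mulr0.
- under eq_fun do rewrite mevalXU.
  apply: is_derive_eq; first exact: is_derive_coord.
  rewrite (bigD1 i) //= mderivX mnm1E eqxx scale1r.
  have -> : mnm_sub (mnm1 i) (mnm1 i) = @mnm0 3.
    by apply/mnmP => j; rewrite mnmBE mnm0E subnn.
  rewrite mpolyX0 meval1 mulr1 big1 ?addr0 // => j ji.
  by rewrite mderivX mnm1E eq_sym (negPf ji) scale0r meval0 mulr0.
- under eq_fun do rewrite mevalD.
  apply: is_derive_eq.
  by rewrite -big_split /=; apply: eq_bigr => i _; rewrite mderivD mevalD mulrDr.
- under eq_fun do rewrite mevalM.
  apply: is_derive_eq.
  rewrite !scaler_sumr -big_split /=; apply: eq_bigr => i _.
  by rewrite mderivM mevalD !mevalM /GRing.scale /=; ring.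
Qed.

(** * The inverse estimate on a cube *)

Lemma inverse_estimate_line (R : realType) (k : nat) (M a s x c : R)
    (f : R -> R) (p : {poly R}) :
  0 < s -> 0 <= M -> 0 <= c -> (size p <= k.+1)%N ->
  (forall t, f t = c * p.[t] ^+ 2) ->
  a - M * s <= x <= a + s + M * s ->
  ((s * f x)%:E <= (inverse_const k M)%:E *
     \int[@lebesgue_measure R]_(t in [set` `[a, (a + s)%R]]) (f t)%:E)%E.
Proof.
move=> s0 M0 c0 sp fE ax.
have fE' t : f t = (Num.sqrt c *: p).[t] ^+ 2.
  by rewrite hornerZ exprMn sqr_sqrtr.
rewrite fE'; under eq_integral do rewrite fE'.
by apply: inverse_estimate_1d => //; rewrite (leq_trans (size_scale_leq _ _)).
Qed.

(** One step of the iteration over coordinates: Tonelli integrates a bound that holds on every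
    slice. The integrand is extended by zero outside [A] x [B] to apply it on the whole product
    space. *)
Lemma slice_le_integral (d1 d2 : measure_display) (T1 : measurableType d1)
    (T2 : measurableType d2) (R : realType)
    (m1 : {sigma_finite_measure set T1 -> \bar R})
    (m2 : {sigma_finite_measure set T2 -> \bar R})
    (A : set T1) (B : set T2) (f : T1 * T2 -> R) (g : T1 -> R) (c : R) :
  measurable A -> measurable B -> measurable_fun setT f ->
  (forall z, 0 <= f z) -> (forall x, 0 <= g x) -> 0 <= c ->
  (forall x, A x -> ((g x)%:E <= c%:E * \int[m2]_(y in B) (f (x, y))%:E)%E) ->
  (\int[m1]_(x in A) (g x)%:E <=
     c%:E * \int[(m1 \x m2)%E]_(z in A `*` B) (f z)%:E)%E.
Proof.
move=> mA mB mf f0 g0 c0 gf.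
rewrite [in leRHS]integral_mkcond.
set F := ((fun z => (f z)%:E) \_ (A `*` B))%E.
have F0 z : (0 <= F z)%E by rewrite /F patchE; case: ifP; rewrite ?lee_fin.
have mF : measurable_fun setT F.
  apply/(measurable_restrictT _ _).1 => //; first exact: measurableX.
  by apply/measurable_EFinP; exact: measurable_funTS.
rewrite fubini_tonelli1 // -ge0_integralZl //; first last.
- by move=> x _; exact: integral_ge0.
- exact: measurable_fun_fubini_tonelli_F.
apply: ge0_le_integral_set => // [x _|x _|x Ax].
- by rewrite lee_fin.
- by rewrite mule_ge0 ?lee_fin //; exact: integral_ge0.
- apply: le_trans (gf x Ax) _; rewrite lee_wpmul2l ?lee_fin //.
  rewrite integral_mkcond /fubini_F; apply: ge0_le_integral_set => // y _.
    by rewrite patchE; case: ifP; rewrite ?lee_fin.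
  rewrite /F !patchE; case: ifPn => [yB|_].
    by rewrite mem_set //; split => //; exact: set_mem.
  by case: ifP; rewrite ?lee_fin.
Qed.

Lemma sigma_finite_leb2 (R : realType) : sigma_finite setT (leb2 R).
Proof.
exists (fun n : nat => [set` `[- (n%:R : R), n%:R]] `*` [set` `[- (n%:R : R), n%:R]]).
  apply/esym; rewrite -subTset => -[x y] _.
  exists (Num.bound `|x| + Num.bound `|y|)%N => //; rewrite natrD.
  have := archi_boundP (normr_ge0 x); have := archi_boundP (normr_ge0 y) => xb yb.
  by split; rewrite /= in_itv /= -ler_norml ltW //; [exact: ltr_wpDr|exact: ltr_wpDl].
move=> n; split; first exact: measurableX.
pose I : set R := [set` `[- n%:R, n%:R]].
have fin : (@lebesgue_measure R I < +oo)%E.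
  by rewrite /I lebesgue_measure_itv /=; case: ifP => _; rewrite -?EFinB ltry.
have -> := product_measure1E (@lebesgue_measure R) (@lebesgue_measure R)
  (measurable_itv _) (measurable_itv _).
by rewrite lte_mul_pinfty // ge0_fin_numE.
Qed.

(** [leb3] is the product of [leb2] with a line, so the last Tonelli step takes [leb2] as a
    sigma-finite factor. *)
Definition leb2_sigma_finite (R : realType) :
    {sigma_finite_measure set (measurableTypeR R * measurableTypeR R)%type -> \bar R} :=
  HB.pack (leb2 R) (@Measure_isSigmaFinite.Build _ _ _ (leb2 R) (@sigma_finite_leb2 R)).

Definition box (R : realType) (a : 'rV[R]_3) (s : R) : set (coords R) :=
  [set` `[a 0 0, (a 0 0 + s)%R]] `*` [set` `[a 0 1, (a 0 1 + s)%R]] `*`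
  [set` `[a 0 2%:R, (a 0 2%:R + s)%R]].

Lemma inverse_estimate_3d (R : realType) (k : nat) (M s : R) (a x : 'rV[R]_3)
    (p : mpoly 3 R) :
  0 < s -> 0 <= M -> (msize p <= k.+1)%N ->
  (forall i, a 0 i - M * s <= x 0 i <= a 0 i + s + M * s) ->
  ((s ^+ 3 * meval (x 0) p ^+ 2)%:E <= (inverse_const k M ^+ 3)%:E *
     \int[leb3 R]_(u in box a s) (meval (of_coords u 0) p ^+ 2)%:E)%E.
Proof.
move=> s0 M0 sp ax.
pose x0 := x 0 0; pose x1 := x 0 1; pose x2 := x 0 2%:R.
pose a0 := a 0 0; pose a1 := a 0 1; pose a2 := a 0 2%:R.
set C := inverse_const k M.
have C0 : 0 <= C by exact: inverse_const_ge0.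
pose g (u v w : R) := meval (of_coords (u, v, w) 0) p ^+ 2.
have mg : measurable_fun setT (fun z : coords R => meval (of_coords z 0) p ^+ 2).
  by apply: measurable_funX; exact: measurable_meval.
have s2_ge0 : 0 <= s ^+ 2 by exact: sqr_ge0.
have lineP (b d : 'rV[R]_3) (f : R -> R) :
    (forall t, f t = meval ((b + t *: d) 0) p) ->
    exists2 q : {poly R}, (size q <= k.+1)%N & forall t, f t = q.[t].
  move=> fE; have [q sq qE] := meval_line (b 0) (d 0) sp; exists q => // t.
  by rewrite fE -qE; apply: meval_eq => i; rewrite !mxE.
(* The coordinates not yet reached stay frozen at those of x: [H1] passes from the point to a
   segment, [H2] from there to a square and [H3] to the cube. The powers of [s] already gathered
   form the factor [c] of [inverse_estimate_line]. *)
have H3 u v : ((s * g u v x2)%R%:E <= C%:E *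
    \int[@lebesgue_measure R]_(w in [set` `[a2, (a2 + s)%R]]) (g u v w)%:E)%E.
  have [|q sq qE] := @lineP (of_coords (u, v, 0)) (of_coords (0, 0, 1))
     (fun t => meval (of_coords (u, v, t) 0) p).
    move=> t; congr (meval _ p); apply/funext => i; rewrite !mxE.
    by case: i => [[|[|[|i]]]] //= _; ring.
  apply: (@inverse_estimate_line _ _ _ _ _ _ 1 _ q) => //; last exact: ax.
  by move=> t; rewrite mul1r /g qE.
have H2 u : ((s * (s * g u x1 x2))%R%:E <= C%:E *
    \int[@lebesgue_measure R]_(v in [set` `[a1, (a1 + s)%R]]) (s * g u v x2)%R%:E)%E.
  have [|q sq qE] := @lineP (of_coords (u, 0, x2)) (of_coords (0, 1, 0))
     (fun t => meval (of_coords (u, t, x2) 0) p).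
    move=> t; congr (meval _ p); apply/funext => i; rewrite !mxE.
    by case: i => [[|[|[|i]]]] //= _; ring.
  apply: (@inverse_estimate_line _ _ _ _ _ _ s
    (fun v => s * g u v x2) q) => //; last exact: ax.
    exact: ltW.
  by move=> t; rewrite /g qE.
have H1 : ((s * (s * (s * g x0 x1 x2)))%:E <= C%:E *
    \int[@lebesgue_measure R]_(u in [set` `[a0, (a0 + s)%R]]) (s * (s * g u x1 x2))%R%:E)%E.
  have [|q sq qE] := @lineP (of_coords (0, x1, x2)) (of_coords (1, 0, 0))
     (fun t => meval (of_coords (t, x1, x2) 0) p).
    move=> t; congr (meval _ p); apply/funext => i; rewrite !mxE.
    by case: i => [[|[|[|i]]]] //= _; ring.
  apply: (@inverse_estimate_line _ _ _ _ _ _ (s ^+ 2)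
    (fun u => s * (s * g u x1 x2)) q) => //; last exact: ax.
  by move=> t; rewrite /g qE expr2 mulrA.
have -> : s ^+ 3 * meval (x 0) p ^+ 2 = s * (s * (s * g x0 x1 x2)).
  have -> : g x0 x1 x2 = meval (x 0) p ^+ 2.
    congr (meval _ p ^+ 2); apply/funext => i; rewrite mxE.
    by case: i => [[|[|[|i]]]] //= ?; congr (x 0 _); apply/val_inj.
  ring.
clearbody C; apply: le_trans H1 _; rewrite [C ^+ 3]exprS expr2 !EFinM -!muleA.
rewrite lee_wpmul2l ?lee_fin //.
have H21 := @slice_le_integral _ _ _ _ _ (@lebesgue_measure R)
  (@lebesgue_measure R) [set` `[a0, a0 + s]] [set` `[a1, a1 + s]]
  (fun z => s * g z.1 z.2 x2) (fun u => s * (s * g u x1 x2)) C.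
apply: (le_trans (H21 _ _ _ _ _ C0 (fun u _ => H2 u))) => //.
- apply: measurable_funM => //.
  apply: (@measurableT_comp _ _ _ _ _ _ _ _
    (fun z : measurableTypeR R * measurableTypeR R => (z, x2)) mg).
  by apply: measurable_fun_pair.
- by move=> z; rewrite mulr_ge0 ?sqr_ge0 // ltW.
- by move=> u; exact: mulr_ge0 (ltW s0) (mulr_ge0 (ltW s0) (sqr_ge0 _)).
rewrite lee_wpmul2l ?lee_fin //.
have H32 := @slice_le_integral _ _ _ _ _
  (leb2_sigma_finite R)
  (@lebesgue_measure R)
  ([set` `[a0, a0 + s]] `*` [set` `[a1, a1 + s]]) [set` `[a2, a2 + s]]
  (fun z : coords R => meval (of_coords z 0) p ^+ 2)
  (fun z => s * g z.1 z.2 x2) C.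
apply: (H32 _ _ mg _ _ C0) => //.
- exact: measurableX.
- by move=> z; rewrite sqr_ge0.
- by move=> z; exact: mulr_ge0 (ltW s0) (sqr_ge0 _).
Qed.

(** * Euclidean geometry *)

Lemma dotE (R : realType) (x y : 'rV[R]_3) :
  dot x y = x 0 0 * y 0 0 + x 0 1 * y 0 1 + x 0 2%:R * y 0 2%:R.
Proof.
rewrite /dot !big_ord_recl big_ord0 addr0 addrA.
by congr (_ + _ * _ + _ * _); congr (_ 0 _); apply/val_inj.
Qed.

Lemma crossE (R : realType) (a b : 'rV[R]_3) :
  [/\ cross a b 0 0 = a 0 1 * b 0 2%:R - a 0 2%:R * b 0 1,
      cross a b 0 1 = a 0 2%:R * b 0 0 - a 0 0 * b 0 2%:R
    & cross a b 0 2%:R = a 0 0 * b 0 1 - a 0 1 * b 0 0].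
Proof. by split; rewrite mxE. Qed.

Lemma row3P (R : realType) (x y : 'rV[R]_3) :
  x 0 0 = y 0 0 -> x 0 1 = y 0 1 -> x 0 2%:R = y 0 2%:R -> x = y.
Proof.
move=> e0 e1 e2; apply/rowP => i; case: i => [[|[|[|i]]] //= ltj].
- by rewrite (_ : Ordinal ltj = 0) //; apply/val_inj.
- by rewrite (_ : Ordinal ltj = 1) //; apply/val_inj.
- by rewrite (_ : Ordinal ltj = 2%:R) //; apply/val_inj.
Qed.

Lemma dotC (R : realType) (x y : 'rV[R]_3) : dot x y = dot y x.
Proof. by rewrite !dotE; ring. Qed.

Lemma dotDl (R : realType) (x y z : 'rV[R]_3) :
  dot (x + y) z = dot x z + dot y z.
Proof. by rewrite !dotE !mxE; ring. Qed.

Lemma dotZl (R : realType) (a : R) (x z : 'rV[R]_3) :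
  dot (a *: x) z = a * dot x z.
Proof. by rewrite !dotE !mxE; ring. Qed.

Lemma dot_ge0 (R : realType) (x : 'rV[R]_3) : 0 <= dot x x.
Proof. by apply: sumr_ge0 => i _; rewrite -expr2 sqr_ge0. Qed.

Lemma dot_eq0 (R : realType) (x : 'rV[R]_3) : (dot x x == 0) = (x == 0).
Proof.
apply/eqP/eqP => [x0|->]; last by rewrite dotE !mxE; ring.
apply/rowP => i; rewrite mxE; apply/eqP; rewrite -sqrf_eq0 expr2.
have := psumr_eq0P (F := fun i => x 0 i * x 0 i) _ x0.
by move=> -> // j _; rewrite -expr2 sqr_ge0.
Qed.

Lemma enorm_ge0 (R : realType) (x : 'rV[R]_3) : 0 <= enorm x.
Proof. exact: sqrtr_ge0. Qed.

Lemma sqr_enorm (R : realType) (x : 'rV[R]_3) : enorm x ^+ 2 = dot x x.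
Proof. by rewrite sqr_sqrtr // dot_ge0. Qed.

Lemma enorm_eq0 (R : realType) (x : 'rV[R]_3) : (enorm x == 0) = (x == 0).
Proof. by rewrite -dot_eq0 -sqr_enorm sqrf_eq0. Qed.

Lemma enorm_le (R : realType) (x : 'rV[R]_3) (r : R) :
  0 <= r -> (enorm x <= r) = (dot x x <= r ^+ 2).
Proof. by move=> r0; rewrite -sqr_enorm ler_sqr ?nnegrE ?enorm_ge0. Qed.

(** Lagrange's identity; it yields both the Cauchy-Schwarz inequality and the bound on the area
    element of a face. *)
Lemma dot_cross (R : realType) (a b : 'rV[R]_3) :
  dot (cross a b) (cross a b) = dot a a * dot b b - dot a b ^+ 2.
Proof.
by have [c0 c1 c2] := crossE a b; rewrite !dotE c0 c1 c2; ring.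
Qed.

Lemma sqr_dot_le (R : realType) (a b : 'rV[R]_3) :
  dot a b ^+ 2 <= dot a a * dot b b.
Proof. by rewrite -subr_ge0 -dot_cross dot_ge0. Qed.

Lemma enorm_cross_le (R : realType) (a b : 'rV[R]_3) :
  enorm (cross a b) <= enorm a * enorm b.
Proof.
rewrite enorm_le ?mulr_ge0 ?enorm_ge0 // exprMn !sqr_enorm dot_cross.
by rewrite lerBlDr lerDl sqr_ge0.
Qed.

Lemma ler_enormD (R : realType) (x y : 'rV[R]_3) :
  enorm (x + y) <= enorm x + enorm y.
Proof.
rewrite enorm_le ?addr_ge0 ?enorm_ge0 // sqrrD !sqr_enorm.
have -> : dot (x + y) (x + y) = dot x x + dot x y *+ 2 + dot y y.
  by rewrite !dotE !mxE; ring.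
rewrite lerD2r lerD2l ler_pMn2r //; apply: le_trans (ler_norm _) _.
rewrite -ler_sqr ?nnegrE ?mulr_ge0 ?enorm_ge0 //.
by rewrite real_normK ?num_real // exprMn !sqr_enorm sqr_dot_le.
Qed.

Lemma enormZ (R : realType) (a : R) (x : 'rV[R]_3) :
  enorm (a *: x) = `|a| * enorm x.
Proof.
rewrite /enorm dotZl dotC dotZl mulrA -expr2 sqrtrM ?sqr_ge0 //.
by rewrite sqrtr_sqr.
Qed.

Lemma enormN (R : realType) (x : 'rV[R]_3) : enorm (- x) = enorm x.
Proof. by rewrite -scaleN1r enormZ normrN1 mul1r. Qed.

Lemma coord_le_enorm (R : realType) (x : 'rV[R]_3) (i : 'I_3) :
  `|x 0 i| <= enorm x.
Proof.
rewrite -ler_sqr ?nnegrE ?enorm_ge0 // real_normK ?num_real // sqr_enorm /dot.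
rewrite (bigD1 i) //= -expr2 lerDl; apply: sumr_ge0 => j _.
by rewrite -expr2 sqr_ge0.
Qed.

(** The factor 2 is a rational bound for the square root of 3. *)
Lemma enorm_le_coord (R : realType) (x : 'rV[R]_3) (r : R) :
  (forall i, `|x 0 i| <= r) -> enorm x <= 2 * r.
Proof.
move=> xr; have r0 : 0 <= r by apply: le_trans (xr 0).
rewrite enorm_le ?mulr_ge0 //; apply: le_trans (_ : \sum_(i < 3) r ^+ 2 <= _).
  by apply: ler_sum => i _; rewrite -expr2 -real_normK ?num_real // ler_sqr ?nnegrE.
by rewrite sumr_const card_ord exprMn; have := sqr_ge0 r; lra.
Qed.

Lemma enorm_cball_nbhs (R : realType) (x : 'rV[R]_3) (r : R) :
  0 < r -> nbhs x [set y | enorm (y - x) <= r].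
Proof.
move=> r0; apply/nbhs_ballP; exists (r / 2) => /=; first by rewrite divr_gt0.
move=> y xy; have -> : r = 2 * (r / 2) by rewrite mulrC divfK.
apply: enorm_le_coord => i; rewrite !mxE ltW // distrC.
exact: (xy.2 0 i).
Qed.

Lemma nbhs_segment (R : realType) (x d : 'rV[R]_3) (U : set 'rV[R]_3) :
  nbhs x U -> exists2 t : R, 0 < t <= 1 & U (x + t *: d).
Proof.
move=> xU.
have cd : (fun t : R => x + t *: d) @ (0 : R)^'+ --> x.
  rewrite -[X in _ --> X]addr0 -[X in _ + X](scale0r d).
  apply: cvgD; first exact: cvg_cst.
  apply: cvgZl; apply: cvg_at_right_filter; exact: cvg_id.
have H : \forall t \near (0 : R)^'+, 0 < t <= 1 /\ U (x + t *: d).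
  near=> t; split; last by near: t; exact: cd.
  by apply/andP; split; near: t; [exact: nbhs_right_gt|exact: nbhs_right_le].
by have [t [t01 Ut]] := filter_ex H; exists t.
Unshelve. all: by end_near. Qed.

Definition normalized (R : realType) (c : 'rV[R]_3) : 'rV[R]_3 :=
  (enorm c)^-1 *: c.

(** An inequality, because the zero vector is normalized to zero (the inverse of 0 is 0). *)
Lemma dot_normalized_le1 (R : realType) (c : 'rV[R]_3) :
  dot (normalized c) (normalized c) <= 1.
Proof.
rewrite dotZl dotC dotZl mulrA -expr2 -sqr_enorm -exprMn.
have [->|c0] := eqVneq (enorm c) 0; first by rewrite mulr0 expr0n.
by rewrite mulVf // expr1n.
Qed.

(** A vector orthogonal to two independent vectors is a multiple of their cross product, hence
    purely normal. *)
Lemma tang_comp_cross (R : realType) (g a b : 'rV[R]_3) :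
  cross a b != 0 -> dot g a = 0 -> dot g b = 0 ->
  tang_comp g (normalized (cross a b)) = 0.
Proof.
move=> ab0 ga gb; set c := cross a b.
have cc0 : dot c c != 0 by rewrite dot_eq0.
(* The coefficients below are the components in the double product formula (c.c) g - (g.c) c = c x
   (g x c) = (g.b) (c x a) - (g.a) (c x b). *)
have gc i : dot c c * g 0 i = dot g c * c 0 i.
  apply/eqP; rewrite -subr_eq0; apply/eqP.
  have [c0 c1 c2] := crossE a b; rewrite -/c in c0 c1 c2.
  have H (x u v : R) : x = u * dot g a + v * dot g b -> x = 0.
    by rewrite ga gb !mulr0 addr0.
  case: i => [[|[|[|i]]] //= ltj].
  - rewrite (_ : Ordinal ltj = 0); last exact/val_inj.
    apply: (H _ (c 0 2%:R * b 0 1 - c 0 1 * b 0 2%:R) (c 0 1 * a 0 2%:R - c 0 2%:R * a 0 1)).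
    by rewrite !dotE c0 c1 c2; ring.
  - rewrite (_ : Ordinal ltj = 1); last exact/val_inj.
    apply: (H _ (c 0 0 * b 0 2%:R - c 0 2%:R * b 0 0) (c 0 2%:R * a 0 0 - c 0 0 * a 0 2%:R)).
    by rewrite !dotE c0 c1 c2; ring.
  - rewrite (_ : Ordinal ltj = 2%:R); last exact/val_inj.
    apply: (H _ (c 0 1 * b 0 0 - c 0 0 * b 0 1) (c 0 0 * a 0 1 - c 0 1 * a 0 0)).
    by rewrite !dotE c0 c1 c2; ring.
have c0 : enorm c != 0 by rewrite enorm_eq0.
clearbody c.
apply/rowP => i; rewrite /tang_comp /normalized dotC dotZl !mxE.
rewrite -[g 0 i](mulKf cc0) gc -sqr_enorm.
by rewrite (dotC c g); field.
Qed.

Lemma ddot_ge0 (R : realType) (S : 'M[R]_3) : 0 <= ddot S S.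
Proof.
by do 2![apply: sumr_ge0 => ? _]; rewrite -expr2 sqr_ge0.
Qed.

(** Cauchy-Schwarz twice: for the product of S n with n, then for each row of S with n. *)
Lemma sqr_nn_comp_le (R : realType) (S : 'M[R]_3) (n : 'rV[R]_3) :
  dot n n <= 1 -> nn_comp S n ^+ 2 <= ddot S S.
Proof.
move=> n1; apply: le_trans (sqr_dot_le _ _) _.
apply: le_trans (ler_wpM2l (dot_ge0 _) n1) _; rewrite mulr1.
apply: ler_sum => i _; rewrite -expr2.
have -> : (n *m S^T) 0 i = dot (row i S) n.
  by rewrite mxE dotC; apply: eq_bigr => j _; rewrite !mxE.
apply: le_trans (sqr_dot_le _ _) _.
apply: le_trans (ler_wpM2l (dot_ge0 _) n1) _; rewrite mulr1.
by apply: ler_sum => j _; rewrite !mxE.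
Qed.

(** * Simplices *)

Lemma vtx_hull (R : realType) (M : mesh R) (A : {set 'I_(nvtx M)})
    (i : 'I_(nvtx M)) : i \in A -> hull A (vtx i).
Proof.
move=> iA; exists (fun j => (j == i)%:R); split=> [j|j jA||].
- exact: ler0n.
- by case: eqVneq jA => // ->; rewrite iA.
- by rewrite (bigD1 i) //= eqxx big1 ?addr0 // => j /negPf ->.
- by rewrite (bigD1 i) //= eqxx scale1r big1 ?addr0 // => j /negPf ->; rewrite scale0r.
Qed.

Lemma hullS (R : realType) (M : mesh R) (A B : {set 'I_(nvtx M)}) :
  A \subset B -> hull A `<=` hull B.
Proof.
move=> /fintype.subsetP AB x [l [l0 lA l1 xE]]; exists l; split => // i iB.
by apply: lA; apply: contra iB; exact: AB.
Qed.

Lemma hull_convex (R : realType) (M : mesh R) (A : {set 'I_(nvtx M)})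
    (x y : 'rV[R]_3) (t : R) :
  hull A x -> hull A y -> 0 <= t <= 1 -> hull A (x + t *: (y - x)).
Proof.
move=> [l [l0 lA l1 xE]] [m [m0 mA m1 yE]] /andP[t0 t1].
exists (fun i => (1 - t) * l i + t * m i); split=> [i|i iA||].
- by rewrite addr_ge0 // mulr_ge0 // subr_ge0.
- by rewrite lA // mA // !mulr0 addr0.
- by rewrite big_split /= -!mulr_sumr l1 m1 !mulr1 subrK.
- under eq_bigr do rewrite scalerDl -!scalerA.
  rewrite big_split /= -!scaler_sumr -xE -yE scalerBl scale1r scalerBr.
  by rewrite -addrA; congr (_ + _); rewrite addrC.
Qed.

Lemma hull_bounded (R : realType) (M : mesh R) (A : {set 'I_(nvtx M)})
    (x : 'rV[R]_3) :
  hull A x -> enorm x <= \sum_(i < nvtx M) enorm (vtx i).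
Proof.
move=> [l [l0 _ l1 ->]].
have l_le1 i : l i <= 1.
  rewrite -l1 (bigD1 i) //= lerDl; exact: sumr_ge0.
elim/big_rec2: _ => [|i r y _ yr].
  by rewrite -[0 : 'rV_3](scale0r 0) enormZ normr0 mul0r.
apply: le_trans (ler_enormD _ _) _; apply: lerD yr.
by rewrite enormZ ger0_norm // ler_piMl // enorm_ge0.
Qed.

(** [sup] of an unbounded set is the default 0, so boundedness has to precede any use of [diam] as
    an upper bound. *)
Lemma dist_hull_has_ubound (R : realType) (M : mesh R) (A : {set 'I_(nvtx M)}) :
  has_ubound [set enorm (x - y) | x in hull A & y in hull A].
Proof.
set B := \sum_(i < nvtx M) enorm (vtx i).
exists (B + B) => _ [x xA [y yA <-]].
apply: le_trans (ler_enormD _ _) _.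
by rewrite enormN; apply: lerD; [exact: hull_bounded xA|exact: hull_bounded yA].
Qed.

Lemma enorm_le_diam (R : realType) (M : mesh R) (A : {set 'I_(nvtx M)})
    (x y : 'rV[R]_3) : hull A x -> hull A y -> enorm (x - y) <= diam (hull A).
Proof.
move=> xA yA; apply: ub_le_sup; first exact: dist_hull_has_ubound.
by exists x => //; exists y.
Qed.

Lemma diam_ge0 (R : realType) (M : mesh R) (A : {set 'I_(nvtx M)}) :
  0 <= diam (hull A).
Proof.
have [[x xA]|A0] := pselect (hull A !=set0).
  by apply: le_trans (enorm_le_diam xA xA); exact: enorm_ge0.
rewrite /diam (_ : [set _ | _ in _ & _ in _] = set0) ?sup0 //.
by rewrite -subset0 => z [x xA _]; case: A0; exists x.
Qed.

Lemma diamS (R : realType) (M : mesh R) (A B : {set 'I_(nvtx M)}) :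
  A \subset B -> diam (hull A) <= diam (hull B).
Proof.
move=> AB; have [[x xA]|A0] := pselect (hull A !=set0).
  apply: sup_le_ub; first by exists (enorm (x - x)), x => //; exists x.
  by move=> _ [y yA [z zA <-]]; apply: enorm_le_diam; exact: hullS zA || exact: hullS yA.
rewrite {1}/diam (_ : [set _ | _ in _ & _ in _] = set0) ?sup0 ?diam_ge0 //.
by rewrite -subset0 => z [y yA _]; case: A0; exists y.
Qed.

(** Two distinct vertices make the diameter positive, which excludes the default value 0 of the
    supremum in [inradius]. A ball with more than half the supremal radius is taken, and this turns
    the factor 2 of shape regularity into 4. *)
Lemma shape_regular_ball (R : realType) (Omega GammaD GammaN : set 'rV[R]_3)
    (M : mesh R) (gamma : R) (T : {set 'I_(nvtx M)}) :
  triangulation Omega GammaD GammaN M -> shape_regular gamma M ->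
  T \in elts M ->
  exists x0 r, [/\ 0 < r, forall y, enorm (y - x0) <= r -> hull T y
                 & diam (hull T) <= 4 * `|gamma| * r].
Proof.
move=> tri sr TM.
have [i [j [iT jT ij]]] : exists i j, [/\ i \in T, j \in T & i != j].
  have : (1 < #|T|)%N by rewrite (tri_card tri TM).
  by move=> /card_gt1P[i [j [iT jT ij]]]; exists i, j.
have d0 : 0 < diam (hull T).
  apply: lt_le_trans (enorm_le_diam (vtx_hull iT) (vtx_hull jT)).
  rewrite lt_neqAle enorm_ge0 andbT eq_sym enorm_eq0 subr_eq0.
  by apply: contra ij => /eqP/(tri_vtx_inj tri) ->.
have := sr T TM; rewrite /inradius; set S := [set r : R | _] => dS.
have S0 : 0 <= sup S.
  have [[r Sr]|S0] := pselect (S !=set0); last first.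
    by rewrite (_ : S = set0) ?sup0 //; apply/eqP/negPn/negP => /set0P.
  have [uS|/(conj (ex_intro S r Sr)) ] := pselect (has_ubound S).
    by apply: le_trans (ub_le_sup uS Sr); case: Sr.
  by move=> [_ nS]; rewrite sup_out // => -[].
have gS0 : 0 < gamma * sup S.
  by have := lt_le_trans d0 dS; rewrite mulrCA pmulr_rgt0.
have Sgt0 : 0 < sup S.
  by rewrite lt_neqAle S0 andbT; apply: contraTneq gS0 => <-; rewrite mulr0 ltxx.
have hS : has_sup S.
  by apply: contrapT => /sup_out S1; rewrite S1 ltxx in Sgt0.
have [r Sr rS] := sup_adherent (divr_gt0 Sgt0 (ltr0Sn _ 1)) hS.
have r_gt : sup S / 2 < r by apply: le_lt_trans rS; rewrite lerBrDr -splitr.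
have [_ [x0 x0r]] := Sr.
exists x0, r; split => //; first by apply: lt_trans r_gt; rewrite divr_gt0.
apply: le_trans dS _; rewrite mulrCA.
have -> : 4 * `|gamma| * r = 2 * (`|gamma| * (2 * r)) by ring.
rewrite ler_pM2l //; apply: le_trans (ler_wpM2r S0 (ler_norm gamma)) _.
by rewrite ler_wpM2l // mulrC -ler_pdivrMr // ltW.
Qed.

(** By convexity, shrinking the inner ball towards x by a factor t gives a ball inside the hull,
    centred on the segment from x to [x0]; its centre is thus an interior point, as close to x as
    desired. *)
Lemma hull_sub_closure_elem (R : realType) (M : mesh R)
    (T : {set 'I_(nvtx M)}) (x0 : 'rV[R]_3) (r : R) :
  0 < r -> (forall y, enorm (y - x0) <= r -> hull T y) ->
  hull T `<=` closure (elem T).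
Proof.
move=> r0 x0r x xT U xU.
have [t /andP[t0 t1] Ut] := nbhs_segment (x0 - x) xU.
exists (x + t *: (x0 - x)); split => //.
have : nbhs (x + t *: (x0 - x)) [set y | enorm (y - (x + t *: (x0 - x))) <= t * r].
  by apply: enorm_cball_nbhs; rewrite mulr_gt0.
apply: filterS => z /= zr.
have -> : z = x + t *: (x + t^-1 *: (z - x) - x).
  by rewrite addrAC subrr add0r scalerA divff ?gt_eqF // scale1r addrC subrK.
apply: hull_convex => //; last by rewrite (ltW t0).
apply: x0r; rewrite -(ler_pM2l t0) -{1}(gtr0_norm t0) -enormZ.
have -> // : t *: (x + t^-1 *: (z - x) - x0) = z - (x + t *: (x0 - x)).
by apply/rowP => i; rewrite !mxE; field; rewrite gt_eqF.
Qed.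

(** By conformity a common point z is interior to the hull of T :&: T'. Moving from z towards a
    vertex j of T outside T' stays in that hull for a short while, yet gives j a positive
    barycentric coordinate, against affine independence. *)
Lemma elem_disjoint (R : realType) (Omega GammaD GammaN : set 'rV[R]_3)
    (M : mesh R) (T T' : {set 'I_(nvtx M)}) :
  triangulation Omega GammaD GammaN M -> T \in elts M -> T' \in elts M ->
  T != T' -> elem T `&` elem T' = set0.
Proof.
move=> tri TM TM' TT'; apply/eqP/negPn/negP => /set0P[z].
rewrite /elem -interiorI (tri_conform tri TM TM').
have [j jT jA] : exists2 j, j \in T & j \notin (T :&: T')%SET.
  apply/fintype.subsetPn; apply: contra TT'.
  rewrite finset.subsetI subxx /= => TT'; rewrite eqEcard TT' /=.
  by rewrite (tri_card tri TM) (tri_card tri TM').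
move=> /[dup] /interior_subset [l [l0 lA l1 zE]].
move=> /(nbhs_segment (vtx j - z)) [t /andP[t0 t1] [m [m0 mA m1 zE']]].
pose c i := (1 - t) * l i + t * (i == j)%:R - m i.
have out (i : 'I_(nvtx M)) : i \notin T -> c i = 0.
  move=> iT; rewrite /c lA ?mA ?inE ?(negPf iT) //.
  by case: eqVneq iT => [->|]; rewrite ?jT // !mulr0 subr0 addr0.
have c0 : \sum_i c i = 0.
  rewrite /c sumrB big_split /= -!mulr_sumr l1 m1.
  rewrite (bigD1 j) //= eqxx big1 ?addr0 => [|i /negPf ->] //.
  by rewrite !mulr1 subrK subrr.
have cv : \sum_i c i *: vtx i = 0.
  under eq_bigr do rewrite /c scalerBl scalerDl -!scalerA.
  rewrite sumrB big_split /= -!scaler_sumr -zE -zE'.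
  rewrite (bigD1 j) //= eqxx scale1r big1 ?addr0 => [|i /negPf ->]; last first.
    by rewrite scale0r.
  by rewrite scalerBl scale1r scalerBr [X in X - _]addrAC -addrA addrA subrr.
have sumT (V : zmodType) (F : 'I_(nvtx M) -> V) :
    (forall i, i \notin T -> F i = 0) -> \sum_(i in T) F i = \sum_i F i.
  by move=> F0; rewrite [RHS](bigID (mem T)) /= [X in _ + X]big1 ?addr0.
have := tri_nondeg tri TM (l := c) _ _ jT.
rewrite !sumT // => [/(_ c0 cv)|i /out ->]; last by rewrite scale0r.
rewrite /c eqxx lA // mA // mulr0 add0r subr0 mulr1 => tE.
by rewrite tE ltxx in t0.
Qed.

(** * Lipschitz boundaries *)

Lemma dot_orthogonal (R : realType) (Q : 'M[R]_3) (u : 'rV[R]_3) :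
  Q *m Q^T = 1%:M -> dot (u *m Q) (u *m Q) = dot u u.
Proof.
move=> QQ.
have dotM (x : 'rV[R]_3) : dot x x = (x *m x^T) 0 0.
  by rewrite mxE; apply: eq_bigr => i _; rewrite mxE.
by rewrite !dotM trmx_mul mulmxA -(mulmxA u) QQ mulmx1.
Qed.

(* A boundary point interior to the closure is impossible: points slightly
   above the Lipschitz graph are at positive distance from O. *)
Lemma interior_closure_lipschitz (R : realType) (O : set 'rV[R]_3) :
  open O -> lipschitz_boundary O -> (closure O)° `<=` O.
Proof.
move=> oO lO x xO; apply: contrapT => nOx.
have xb : bdry O x.
  by split; [exact: interior_subset xO|move=> /interior_subset].
have [Q [phi [L [QQ philip near_x]]]] := lO x xb.
have phi0 : phi 0 0 <= 0.
  rewrite leNgt; apply/negP => p0; apply: nOx.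
  by have /= := nbhs_singleton near_x; rewrite subrr mul0mx !mxE => -[_]; apply.
(* The vertical direction of the local chart; [y] below is the boundary point raised by [t]. *)
pose d : 'rV[R]_3 := delta_mx 0 2%:R *m Q^T.
have dQ : d *m Q = delta_mx 0 2%:R by rewrite -mulmxA (mulmx1C QQ) mulmx1.
have [t /andP[t0 _] [near_y Oy]] := nbhs_segment d
  (filterI (nbhs_interior near_x) xO).
set y := x + t *: d in near_y Oy.
(* Within distance delta of [y] the height is at least t - delta = 2 |L| delta, while the graph, at
   most 0 above the origin, rises to at most 2 |L| delta. No such point can lie strictly below the
   graph. *)
pose delta := t / (1 + 2 * `|L|).
have L1 : 0 < 1 + 2 * `|L| by rewrite ltr_pwDl // mulr_ge0.
have delta0 : 0 < delta by rewrite divr_gt0.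
have [z [Oz [zP /= zd]]] := Oy _ (filterI near_y (enorm_cball_nbhs y delta0)).
have wE i : ((z - x) *m Q) 0 i = ((z - y) *m Q) 0 i + t * (i == 2%:R)%:R.
  have -> : z - x = (z - y) + t *: d by rewrite /y opprD addrA subrK.
  by rewrite mulmxDl -scalemxAl dQ !mxE eqxx.
have wd i : `|((z - y) *m Q) 0 i| <= delta.
  apply: le_trans (coord_le_enorm _ _) _.
  by rewrite /enorm dot_orthogonal.
have := (zP.1 Oz); rewrite !wE /= !mulr0 !addr0 mulr1 => w2.
have := philip (((z - y) *m Q) 0 0) (((z - y) *m Q) 0 1) 0 0; rewrite !subr0.
move=> /(le_trans (ler_norm _)) pl.
have pl' : L * (`|((z - y) *m Q) 0 0| + `|((z - y) *m Q) 0 1|) <=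
    `|L| * (delta + delta).
  apply: le_trans (ler_wpM2r _ (ler_norm L)) _; first by rewrite addr_ge0.
  by apply: ler_wpM2l => //; apply: lerD.
have w2' := wd 2%:R; rewrite ler_norml in w2'; case/andP: w2' => w2' _.
have dt : delta * (1 + 2 * `|L|) = t by rewrite divfK // gt_eqF.
by move: dt; lra.
Qed.

(** * Nondegenerate faces *)

Lemma fvtxP (R : realType) (M : mesh R) (F : {set 'I_(nvtx M)}) :
  #|F| = 3%N -> exists i0 i1 i2, [/\ F = [set i0; i1; i2]%SET,
    uniq [:: i0; i1; i2], fvtx F 0 = vtx i0, fvtx F 1 = vtx i1
    & fvtx F 2 = vtx i2].
Proof.
move=> F3; have : size (enum F) = 3%N by rewrite -cardE.
have := enum_uniq F; have := mem_enum F; rewrite /fvtx.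
case: (enum F) => [|i0 [|i1 [|i2 [|]]]] //= memF uF _.
exists i0, i1, i2; split => //.
by apply/finset.setP => i; rewrite -memF !inE orbA.
Qed.

(** The components of the cross product are the 2 x 2 minors of the pair; the conclusion is an
    explicit linear relation, to be fed to affine independence. *)
Lemma cross_eq0 (R : realType) (a b : 'rV[R]_3) (i : 'I_3) :
  cross a b = 0 -> (- b 0 i) *: a + a 0 i *: b = 0.
Proof.
move=> ab0; have [c0 c1 c2] := crossE a b; rewrite ab0 !mxE in c0 c1 c2.
have {}c0 := esym c0; have {}c1 := esym c1; have {}c2 := esym c2.
have i3 : [\/ i = 0, i = 1 | i = 2%:R].
  case: i => [[|[|[|i]]] //= ltj].
  - by apply: Or31; apply/val_inj.
  - by apply: Or32; apply/val_inj.
  - by apply: Or33; apply/val_inj.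
by case: i3 => ->; apply: row3P; rewrite !mxE; lra.
Qed.

Lemma fcross_neq0 (R : realType) (M : mesh R) (T F : {set 'I_(nvtx M)}) :
  aff_indep T -> F \subset T -> #|F| = 3%N -> fcross F != 0.
Proof.
move=> indT FT F3; have [i0 [i1 [i2 [FE uF e0 e1 e2]]]] := fvtxP F3.
move: uF; rewrite /= !inE negb_or andbT => /andP[/andP[i01 i02] i12].
have inT i : i \in F -> i \in T by move/fintype.subsetP: FT; apply.
have [i0T i1T i2T] : [/\ i0 \in T, i1 \in T & i2 \in T].
  by split; apply: inT; rewrite FE !inE eqxx ?orbT.
rewrite /fcross e0 e1 e2; set a := vtx i1 - _; set b := vtx i2 - _.
have indep s t : s *: a + t *: b = 0 -> s = 0 /\ t = 0.
  move=> st0.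
  (* The weight -(s + t) at [i0] makes the sum zero and turns a linear relation between the edge
     vectors into an affine relation between the vertices. *)
  pose l i : R := (i == i1)%:R * s + (i == i2)%:R * t - (i == i0)%:R * (s + t).
  have sum_delta (V : lmodType R) (G : 'I_(nvtx M) -> V) j r : j \in T ->
      \sum_(i in T) ((i == j)%:R * r) *: G i = r *: G j.
    move=> jT; rewrite (bigD1 j) //= eqxx mul1r big1 ?addr0 // => i.
    by move=> /andP[_ /negPf ->]; rewrite mul0r scale0r.
  have lG (V : lmodType R) (G : 'I_(nvtx M) -> V) :
      \sum_(i in T) l i *: G i = s *: G i1 + t *: G i2 - (s + t) *: G i0.
    under eq_bigr do rewrite /l scalerBl scalerDl.
    by rewrite sumrB big_split /= !sum_delta.
  have l1 : \sum_(i in T) l i = 0.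
    have := lG R^o (fun=> 1); rewrite /GRing.scale /=.
    by under eq_bigr do rewrite mulr1; move=> ->; rewrite !mulr1 subrr.
  have lv : \sum_(i in T) l i *: vtx i = 0.
    by rewrite lG -st0 /a /b !scalerBr scalerDl opprD addrACA.
  have lT := indT l l1 lv.
  have := lT _ i1T; have := lT _ i2T; rewrite /l !eqxx.
  rewrite [i2 == i1]eq_sym [i2 == i0]eq_sym [i1 == i0]eq_sym.
  rewrite (negPf i01) (negPf i02) (negPf i12) !mul0r !mul1r subr0 add0r subr0 addr0.
  by move=> -> ->.
apply/eqP => ab0.
have a0 : a = 0.
  by apply/rowP => i; rewrite [RHS]mxE; have [] := indep _ _ (cross_eq0 i ab0).
have [|/eqP] := indep 1 0; first by rewrite a0 scaler0 scale0r addr0.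
by rewrite oner_eq0.
Qed.

Lemma fvtx_hull (R : realType) (M : mesh R) (F : {set 'I_(nvtx M)}) (n : nat) :
  #|F| = 3%N -> (n < 3)%N -> hull F (fvtx F n).
Proof.
move=> F3 n3; have [i0 [i1 [i2 [FE _ e0 e1 e2]]]] := fvtxP F3.
case: n n3 => [|[|[|//]]] _; rewrite ?(e0, e1, e2); apply: vtx_hull.
- by rewrite FE !inE eqxx.
- by rewrite FE !inE eqxx orbT.
- by rewrite FE !inE eqxx !orbT.
Qed.

(** * Measurability in coordinates *)

(** An open set is the union of the rational boxes it contains, and these are countably many. *)
Lemma open_measurable_coords (R : realType) (A : set 'rV[R]_3) :
  open A -> measurable (@of_coords R @^-1` A : set (coords R)).
Proof.
move=> oA.
pose B (q : (rat * rat) * (rat * rat) * (rat * rat)) : set (coords R) :=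
  [set` `]ratr q.1.1.1, ratr q.1.1.2[] `*` [set` `]ratr q.1.2.1, ratr q.1.2.2[] `*`
  [set` `]ratr q.2.1, ratr q.2.2[].
have mB q : measurable (B q) by do 2?apply: measurableX.
have -> : @of_coords R @^-1` A =
    \bigcup_(q in [set q | B q `<=` @of_coords R @^-1` A]) B q.
  apply/seteqP; split=> [u Au|u [q Bq /Bq]] //.
  have /nbhs_ballP[e /= e0 eA] := open_nbhs_nbhs (conj oA Au).
  have itv (x : R) : exists q : rat * rat,
      [/\ ratr q.1 < x, x < ratr q.2, x - e < ratr q.1 & ratr q.2 < x + e].
    have [l] := @rat_in_itvoo R (x - e) x (ltac:(by rewrite ltrBlDr ltrDl)).
    have [r] := @rat_in_itvoo R x (x + e) (ltac:(by rewrite ltrDl)).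
    by rewrite !in_itv /= => /andP[? ?] /andP[? ?]; exists (l, r).
  have [q0 [? ? ? ?]] := itv u.1.1.
  have [q1 [? ? ? ?]] := itv u.1.2.
  have [q2 [? ? ? ?]] := itv u.2.
  exists (q0, q1, q2); last first.
    by split; [split|]; rewrite /= in_itv /=; apply/andP; split.
  move=> v [[/= ]]; rewrite !in_itv /= => /andP[? ?] /andP[? ?] /andP[? ?].
  apply: eA; split => // i j; rewrite ord1 !mxE /ball /= ltr_norml.
  by case: j => [[|[|[|j]]] //= _]; apply/andP; split; lra.
rewrite bigcup_mkcond; apply: countable_bigcupT_measurable => [|q].
  exact: countableP.
by case: ifP.
Qed.

Lemma trace_eq_in (R : realType) (M : mesh R) (T : {set 'I_(nvtx M)}) (m n : nat)
    (f g : 'rV[R]_3 -> 'M[R]_(m, n)) (x : 'rV[R]_3) :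
  (forall y, elem T y -> f y = g y) -> trace T f x = trace T g x.
Proof.
move=> fg; apply/matrixP => i j; rewrite !mxE; congr (lim _).
have E : \forall y \near within (elem T) (nbhs x), f y i j = g y i j.
  by near=> y; rewrite fg //; near: y; exact: withinT.
apply/funext => P; apply/propext; split; apply: filterS2 E => y; rewrite /=.
  by move=> ->.
by move=> ->.
Unshelve. all: by end_near. Qed.

Lemma trace_meval (R : realType) (M : mesh R) (T : {set 'I_(nvtx M)}) (m n : nat)
    (f : 'rV[R]_3 -> 'M[R]_(m, n)) (i : 'I_m) (j : 'I_n) (p : mpoly 3 R)
    (x : 'rV[R]_3) :
  closure (elem T) x -> (forall y, elem T y -> f y i j = meval (y 0) p) ->
  trace T f x i j = meval (x 0) p.
Proof.
move=> Tx fp; rewrite mxE.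
have PF : ProperFilter (within (elem T) (nbhs x)).
  exact: within_nbhs_proper.
apply: cvg_lim => //.
have E : within (elem T) (nbhs x) [set y : 'rV[R]_3 | meval (y 0) p = f y i j].
  by apply: filterS (withinT _ _) => y Ty; rewrite /= fp.
apply: cvg_trans (near_eq_cvg E) _.
exact: cvg_within_filter (@continuous_meval R p x).
Qed.

Lemma meval_eq_closure (R : realType) (A : set 'rV[R]_3) (f : 'rV[R]_3 -> R)
    (p : mpoly 3 R) (B : set 'rV[R]_3) :
  {within B, continuous f} -> A `<=` B ->
  (forall y, A y -> f y = meval (y 0) p) ->
  forall x, B x -> closure A x -> f x = meval (x 0) p.
Proof.
move=> cf AB fp x Bx Ax.
have PF : ProperFilter (within A (nbhs x)) by exact: within_nbhs_proper.
have fx : f @ within A (nbhs x) --> f x.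
  move=> U fU; have : @nbhs_subspace _ B x (f @^-1` U) := cf x U fU.
  rewrite -nbhs_subspace_in // => BU.
  apply: filterS (BU : nbhs x (fun y => B y -> U (f y))) => y By Ay.
  exact: By (AB y Ay).
have px : f @ within A (nbhs x) --> meval (x 0) p.
  have E : within A (nbhs x) [set y : 'rV[R]_3 | meval (y 0) p = f y].
    by apply: filterS (withinT _ _) => y Ay; rewrite /= fp.
  apply: cvg_trans (near_eq_cvg E) _.
  exact: cvg_within_filter (@continuous_meval R p x).
exact: (cvg_unique _ fx px).
Qed.

(** * Broken gradients of discrete potentials *)

(** Formal gradient. Unlike [grad w], it remains meaningful on the faces, where gradients from
    neighbouring elements are compared. *)
Definition mgrad (R : realType) (p : mpoly 3 R) (x : 'rV[R]_3) : 'rV[R]_3 :=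
  \row_(j < 3) meval (x 0) (mderiv j p).

Lemma mgradB (R : realType) (p q : mpoly 3 R) (x : 'rV[R]_3) :
  mgrad (p - q) x = mgrad p x - mgrad q x.
Proof. by apply/rowP => j; rewrite !mxE mderivB mevalB. Qed.

Lemma grad_elem (R : realType) (M : mesh R) (T : {set 'I_(nvtx M)})
    (w : 'rV[R]_3 -> R) (p : mpoly 3 R) (x : 'rV[R]_3) :
  (forall y, elem T y -> w y = meval (y 0) p) -> elem T x ->
  grad w x = mgrad p x.
Proof.
move=> wp Tx; apply/rowP => j; rewrite !mxE.
have near_x : \near x, w x = meval (x 0) p.
  by apply: filterS (nbhs_interior Tx) => y; exact: wp.
rewrite (near_eq_derive _ near_x).
rewrite (@derive_val _ _ _ _ _ _ _ (is_derive_meval p x (delta_mx 0 j))).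
rewrite (bigD1 j) //= !mxE !eqxx mul1r big1 ?addr0 // => i ij.
by rewrite mxE (negPf ij) andbF mul0r.
Qed.

Lemma horner_vanish_itv (R : realType) (r : {poly R}) :
  (forall t, 0 <= t <= 1 -> r.[t] = 0) -> forall t, r.[t] = 0.
Proof.
move=> r0 t; set n := size r.
pose tt (i : 'I_n) : R := i%:R / n%:R.
have n0 (i : 'I_n) : 0 < (n%:R : R).
  by rewrite ltr0n (leq_ltn_trans _ (ltn_ord i)).
rewrite (@horner_lagrange _ n tt) // => [|i j].
  apply: big1 => i _; rewrite r0 ?mul0r // divr_ge0 //=.
  by rewrite ler_pdivrMr ?(n0 i) // mul1r ler_nat ltnW.
rewrite /tt => /(congr1 (fun z => z * n%:R)); rewrite !divfK ?gt_eqF ?(n0 i) // => /eqP.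
by rewrite eqr_nat => /eqP/val_inj.
Qed.

(** The derivative is two-sided but x is an endpoint of the segment; the restriction of q to the
    line is a univariate polynomial, so its zeros on the segment spread to the whole line. *)
Lemma mgrad_segment (R : realType) (q : mpoly 3 R) (x y : 'rV[R]_3) :
  (forall t, 0 <= t <= 1 -> meval ((x + t *: (y - x)) 0) q = 0) ->
  dot (mgrad q x) (y - x) = 0.
Proof.
move=> q0.
have [r _ rE] := meval_line (x 0) ((y - x) 0) (leqnSn (msize q)).
have qE t : meval ((x + t *: (y - x)) 0) q = r.[t].
  by rewrite -rE; apply: meval_eq => i; rewrite !mxE.
have r0 : forall t, r.[t] = 0.
  by apply: horner_vanish_itv => t t01; rewrite -qE q0.
have := @derive_val _ _ _ _ _ _ _ (is_derive_meval q x (y - x)).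
rewrite /derive.
have -> : (fun h : R => h^-1 *: (((fun y0 : 'rV[R]_3 => meval (y0 0) q) \o shift x)
    (h *: (y - x)) - meval (x 0) q)) = cst 0.
  apply/funext => h; rewrite /= [h *: _ + x]addrC qE r0.
  by have := qE 0; rewrite scale0r addr0 r0 => ->; rewrite subrr scaler0.
rewrite lim_cst // => D0; apply: etrans (esym D0); apply: eq_bigr => i _.
by rewrite mulrC !mxE.
Qed.

(** The segments from x to the three vertices stay in the face. Subtracting the resulting
    orthogonality relations gives orthogonality to two independent edges, at every point of the
    closed face. *)
Lemma tang_mgrad_vanish (R : realType) (M : mesh R) (T F : {set 'I_(nvtx M)})
    (q : mpoly 3 R) (x : 'rV[R]_3) :
  aff_indep T -> F \subset T -> #|F| = 3%N ->
  (forall y, hull F y -> meval (y 0) q = 0) -> hull F x ->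
  tang_comp (mgrad q x) (fnormal F) = 0.
Proof.
move=> indT FT F3 q0 Fx.
have gF n : (n < 3)%N -> dot (mgrad q x) (fvtx F n - x) = 0.
  move=> n3; apply: mgrad_segment => t t01; apply: q0.
  by apply: hull_convex => //; exact: fvtx_hull.
have gE n : (n < 3)%N -> dot (mgrad q x) (fvtx F n - fvtx F 0) = 0.
  move=> n3; have -> : fvtx F n - fvtx F 0 = (fvtx F n - x) + -1 *: (fvtx F 0 - x).
    by rewrite scaleN1r opprB addrA subrK.
  by rewrite dotC dotDl dotZl ![dot (_ - _) _]dotC !gF // mulr0 addr0.
by apply: tang_comp_cross; rewrite ?gE //; exact: fcross_neq0 indT FT F3.
Qed.

Definition mesh_elems (R : realType) (M : mesh R) : set 'rV[R]_3 :=
  [set x | exists2 T, T \in elts M & elem T x].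

(* On the mesh skeleton [grad w] takes junk values, whose measurability would
   have to be proved; they are replaced by 0. *)
Definition broken_grad (R : realType) (M : mesh R) (w : 'rV[R]_3 -> R)
    (x : 'rV[R]_3) : 'rV[R]_3 :=
  if x \in mesh_elems M then grad w x else 0.

Lemma broken_gradE (R : realType) (M : mesh R) (w : 'rV[R]_3 -> R)
    (T : {set 'I_(nvtx M)}) (x : 'rV[R]_3) :
  T \in elts M -> elem T x -> broken_grad M w x = grad w x.
Proof.
by move=> TM Tx; rewrite /broken_grad mem_set //; exists T.
Qed.

Lemma hull_sub_closure (R : realType) (Omega GammaD GammaN : set 'rV[R]_3)
    (M : mesh R) (T : {set 'I_(nvtx M)}) :
  triangulation Omega GammaD GammaN M -> T \in elts M ->
  hull T `<=` closure Omega.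
Proof. by move=> tri TM x Tx; rewrite (tri_cover tri); exists T. Qed.

Lemma meval_bounded (R : realType) (p : mpoly 3 R) (B : R) :
  exists2 K, 0 <= K & forall x : 'rV[R]_3, enorm x <= B -> `|meval (x 0) p| <= K.
Proof.
elim/mpoly_ring_ind: p => [c|i|p q [K K0 pK] [L L0 qL]|p q [K K0 pK] [L L0 qL]].
- by exists `|c| => // x _; rewrite mevalC.
- exists `|B| => // x xB; rewrite mevalXU.
  exact: le_trans (coord_le_enorm x i) (le_trans xB (ler_norm B)).
- exists (K + L) => [|x xB]; first exact: addr_ge0.
  by rewrite mevalD (le_trans (ler_normD _ _)) // lerD ?pK ?qL.
- exists (K * L) => [|x xB]; first exact: mulr_ge0.
  by rewrite mevalM normrM ler_pM ?pK ?qL.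
Qed.

Lemma leb3_box_lty (R : realType) (a : 'rV[R]_3) (s : R) :
  (leb3 R (box a s) < +oo)%E.
Proof.
have fin (b : R) : (@lebesgue_measure R [set` `[b, (b + s)%R]] < +oo)%E.
  by rewrite lebesgue_measure_itv /=; case: ifP => _; rewrite -?EFinB ltry.
pose I0 : set R := [set` `[a 0 0, a 0 0 + s]].
pose I1 : set R := [set` `[a 0 1, a 0 1 + s]].
pose I2 : set R := [set` `[a 0 2%:R, a 0 2%:R + s]].
have fin2 : (leb2 R (I0 `*` I1) < +oo)%E.
  have E := product_measure1E (@lebesgue_measure R) (@lebesgue_measure R)
    (measurable_itv `[a 0 0, a 0 0 + s]) (measurable_itv `[a 0 1, a 0 1 + s]).
  apply: le_lt_trans (_ : lebesgue_measure I0 * lebesgue_measure I1 < _)%E.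
    by rewrite -E.
  by apply: lte_mul_pinfty; rewrite ?ge0_fin_numE ?measure_ge0 //; exact: fin.
have E := product_measure1E (leb2 R) (@lebesgue_measure R)
  (measurableX (measurable_itv `[a 0 0, a 0 0 + s]) (measurable_itv `[a 0 1, a 0 1 + s]))
  (measurable_itv `[a 0 2%:R, a 0 2%:R + s]).
apply: le_lt_trans (_ : leb2 R (I0 `*` I1) * lebesgue_measure I2 < _)%E.
  by rewrite -E.
by apply: lte_mul_pinfty; rewrite ?ge0_fin_numE ?measure_ge0 //; exact: fin.
Qed.

Section broken_gradient.
Variables (R : realType) (Omega GammaD GammaN : set 'rV[R]_3) (M : mesh R).
Variables (gamma : R) (k : nat) (w : 'rV[R]_3 -> R).
Hypothesis oO : open Omega.
Hypothesis tri : triangulation Omega GammaD GammaN M.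
Hypothesis sr : shape_regular gamma M.
Hypothesis Ww : W_h Omega GammaD k M w.

Let bgrad := broken_grad M w.

Lemma hull_closure_elem T : T \in elts M -> hull T `<=` closure (elem T).
Proof.
move=> TM; have [x0 [r [r0 x0r _]]] := shape_regular_ball tri sr TM.
exact: hull_sub_closure_elem r0 x0r.
Qed.

Lemma trace_broken_grad T (p : mpoly 3 R) x :
  T \in elts M -> (forall y, elem T y -> w y = meval (y 0) p) ->
  hull T x -> trace T bgrad x = mgrad p x.
Proof.
move=> TM wp Tx; apply/rowP => j; rewrite [RHS]mxE.
apply: trace_meval => [|y Ty]; first exact: hull_closure_elem.
by rewrite /bgrad (broken_gradE _ TM Ty) (grad_elem wp Ty) mxE.
Qed.

Lemma W_h_hull T (p : mpoly 3 R) x :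
  T \in elts M -> (forall y, elem T y -> w y = meval (y 0) p) ->
  hull T x -> w x = meval (x 0) p.
Proof.
move=> TM wp Tx; apply: (meval_eq_closure (W_cont Ww) _ wp).
- by move=> y /interior_subset; exact: (hull_sub_closure tri TM).
- exact: (hull_sub_closure tri TM) Tx.
- exact: hull_closure_elem.
Qed.

Lemma tang_trace_broken_grad T (F : {set 'I_(nvtx M)}) (p : mpoly 3 R) x :
  T \in elts M -> F \subset T -> #|F| = 3%N ->
  (forall y, elem T y -> w y = meval (y 0) p) -> hull F x ->
  tang_trace T F bgrad x = tang_comp (mgrad p x) (fnormal F).
Proof.
move=> TM FT F3 wp Fx; rewrite /tang_trace (trace_broken_grad TM wp) //.
exact: hullS Fx.
Qed.

(** The expansion into polynomials cut off by indicators holds at every point, the elements being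
    disjoint and [broken_grad] being 0 off them. Measurability and boundedness are read off from
    it. *)
Lemma broken_grad_coords :
  exists q : {set 'I_(nvtx M)} -> 'I_3 -> mpoly 3 R,
  [/\ forall T i, T \in elts M -> (msize (q T i) <= k.+1)%N,
      forall T i x, T \in elts M -> elem T x -> bgrad x 0 i = meval (x 0) (q T i)
    & forall i x, bgrad x 0 i =
        \sum_(T in elts M) \1_(elem T) x * meval (x 0) (q T i)].
Proof.
have /choice[p pP] (T : {set 'I_(nvtx M)}) : exists p : mpoly 3 R,
    T \in elts M -> (msize p <= k.+2)%N /\ forall y, elem T y -> w y = meval (y 0) p.
  have [TM|] := boolP (T \in elts M); last by exists 0.
  by have [p ?] := W_poly Ww TM; exists p.
exists (fun T i => mderiv i (p T)).
have qE T i x : T \in elts M -> elem T x ->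
    bgrad x 0 i = meval (x 0) (mderiv i (p T)).
  move=> TM Tx; have [_ wp] := pP T TM.
  by rewrite /bgrad (broken_gradE _ TM Tx) (grad_elem wp Tx) mxE.
split => [T i TM|//|i x].
  by apply: msize_mderiv; have [] := pP T TM.
have [[T TM Tx]|nx] := pselect (mesh_elems M x).
  rewrite (qE _ _ _ TM Tx) (bigD1 T) //= indicE mem_set // mul1r.
  rewrite big1 ?addr0 // => T' /andP[T'M T'T].
  rewrite indicE memNset ?mul0r // => T'x.
  have := elem_disjoint tri T'M TM T'T; apply/eqP/set0P; by exists x.
rewrite /bgrad /broken_grad memNset // mxE big1 // => T TM.
by rewrite indicE memNset ?mul0r // => Tx; apply: nx; exists T.
Qed.

Lemma coords_sub_box : exists a s,
  @of_coords R @^-1` Omega `<=` box a s.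
Proof.
pose B := \sum_(i < nvtx M) enorm (vtx i).
exists (const_mx (- B)), (2 * B) => u Ou.
have [T TM Tu] : (\bigcup_(T in [set T | T \in elts M]) hull T) (of_coords u).
  by rewrite -(tri_cover tri); exact: subset_closure.
have uB i : `|of_coords u 0 i| <= B.
  by apply: le_trans (coord_le_enorm _ _) _; exact: hull_bounded Tu.
have u0 := uB 0; have u1 := uB 1; have u2 := uB 2%:R.
rewrite !mxE /= !ler_norml in u0 u1 u2.
have BE : - B + 2 * B = B by ring.
by split; [split|]; rewrite /= in_itv /= mxE BE.
Qed.

Lemma broken_grad_L2 i : in_L2 Omega (fun x => bgrad x 0 i).
Proof.
have [q [_ qE bE]] := broken_grad_coords.
have mO := open_measurable_coords oO.
have mb : measurable_fun setT (fun u : coords R => bgrad (of_coords u) 0 i).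
  have -> : (fun u : coords R => bgrad (of_coords u) 0 i) = fun u =>
      \sum_(T <- enum (elts M)) \1_(@of_coords R @^-1` elem T) u *
        meval (of_coords u 0) (q T i).
    by apply/funext => u; rewrite bE big_enum /=.
  apply: measurable_sum => T; apply: measurable_funM.
    apply: measurable_indic; apply: open_measurable_coords; exact: open_interior.
  exact: measurable_meval.
split; first exact: measurable_funTS.
have [a [s Oas]] := coords_sub_box.
pose B := \sum_(i < nvtx M) enorm (vtx i).
have /choice[K KP] (T : {set 'I_(nvtx M)}) : exists K : R, 0 <= K /\
    forall x : 'rV[R]_3, enorm x <= B -> `|meval (x 0) (q T i)| <= K.
  by have [K ? ?] := meval_bounded (q T i) B; exists K.
apply: measurable_bounded_integrable => //.
- have mbox : measurable (box a s) by do 2?apply: measurableX.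
  exact: le_lt_trans (le_measure _ (mem_set mO) (mem_set mbox) Oas) (leb3_box_lty a s).
- by apply: measurable_funTS; exact: measurable_funX.
- exists ((\sum_(T in elts M) K T) ^+ 2); split; first exact: num_real.
  move=> z /ltW Kz u Ou; apply: le_trans Kz.
  rewrite normrX; apply: lerXn2r; rewrite ?nnegrE //.
    by apply: sumr_ge0 => T _; have [] := KP T.
  rewrite bE; apply: le_trans (ler_norm_sum _ _ _) _; apply: ler_sum => T TM.
  rewrite indicE; case: (boolP (_ \in _)) => uT; last first.
    by rewrite mul0r normr0; have [] := KP T.
  rewrite mul1r; have [_] := KP T; apply.
  by have /set_mem/interior_subset := uT; exact: hull_bounded.
Qed.

Lemma V_h_broken_grad : V_h Omega GammaD k M bgrad.
Proof.
have [q [qs qE _]] := broken_grad_coords.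
have face3 (F : {set 'I_(nvtx M)}) : is_face F -> #|F| = 3%N by case/andP => /eqP.
split.
- exact: broken_grad_L2.
- by move=> T TM i; exists (q T i); split; [exact: qs|move=> x; exact: qE].
- move=> T T' F TM T'M /face3 F3 FT FT' x Fx.
  have [p [_ wp]] := W_poly Ww TM; have [p' [_ wp']] := W_poly Ww T'M.
  rewrite (tang_trace_broken_grad TM FT F3 wp Fx).
  rewrite (tang_trace_broken_grad T'M FT' F3 wp' Fx).
  apply/eqP; rewrite -subr_eq0; apply/eqP.
  (* Both polynomials agree with [w] on the face by continuity. On a Dirichlet face, treated next,
     [p] vanishes by itself. *)
  have pp' y : hull F y -> meval (y 0) (p - p') = 0.
    move=> Fy; rewrite mevalB -(W_h_hull TM wp); last exact: hullS Fy.
    by rewrite -(W_h_hull T'M wp') ?subrr //; exact: hullS Fy.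
  have := tang_mgrad_vanish (tri_nondeg tri TM) FT F3 pp' Fx.
  rewrite mgradB /tang_comp => <-.
  rewrite [in RHS]dotDl -[- mgrad p' x]scaleN1r dotZl scalerDl -scalerA.
  by rewrite !scaleN1r !opprD !opprK addrACA.
- move=> T F TM /face3 F3 FT FG x Fx.
  have [p [_ wp]] := W_poly Ww TM.
  rewrite (tang_trace_broken_grad TM FT F3 wp Fx).
  apply: (tang_mgrad_vanish (tri_nondeg tri TM) FT F3 _ Fx) => y Fy.
  by rewrite -(W_h_hull TM wp) ?(W_bc Ww) //; [exact: FG|exact: hullS Fy].
Qed.

(** Derivatives at points of an open element are local and traces are limits from inside, so b
    ignores the values on the skeleton. *)
Lemma form_b_broken_grad tau : form_b M tau (grad w) = form_b M tau bgrad.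
Proof.
have gE T y : T \in elts M -> elem T y -> grad w y = bgrad y.
  by move=> TM Ty; rewrite /bgrad (broken_gradE _ TM Ty).
have symE T y : T \in elts M -> elem T y -> sym_grad (grad w) y = sym_grad bgrad y.
  move=> TM Ty.
  have jE : Defs.jacobian (grad w) y = Defs.jacobian bgrad y.
    apply/matrixP => i j; rewrite [LHS]mxE [RHS]mxE.
    have E : \near y, grad w y 0 i = bgrad y 0 i.
      by apply: filterS (nbhs_interior Ty) => z Tz; rewrite (gE T).
    exact: (near_eq_derive (delta_mx 0 j) E).
  by rewrite /sym_grad jE.
have volE T : T \in elts M ->
    vol_int (elem T) (fun x => ddot (tau x) (sym_grad (grad w) x)) =
    vol_int (elem T) (fun x => ddot (tau x) (sym_grad bgrad x)).
  move=> TM; apply: eq_Rintegral => u; rewrite inE => Tu.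
  by rewrite (symE T).
have trE T x : T \in elts M -> trace T (grad w) x = trace T bgrad x.
  by move=> TM; apply: trace_eq_in => y; exact: gE.
have faceE T F : T \in elts M ->
    face_int F (fun x => nn_comp (trace T tau x) (outer_normal T F) *
                         dot (trace T (grad w) x) (outer_normal T F)) =
    face_int F (fun x => nn_comp (trace T tau x) (outer_normal T F) *
                         dot (trace T bgrad x) (outer_normal T F)).
  by move=> TM; apply: (congr1 (face_int F)); apply/funext => x; rewrite trE.
rewrite /form_b; apply: (congr1 -%R); apply: eq_bigr => T TM.
by rewrite (volE T TM) (eq_bigr _ (fun F _ => faceE T F TM)).
Qed.

End broken_gradient.

Lemma b_sup_eq0 (R : realType) (Omega GammaD GammaN : set 'rV[R]_3)
    (M : mesh R) (gamma : R) (k : nat) (tau : 'rV[R]_3 -> 'M[R]_3) :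
  open Omega -> triangulation Omega GammaD GammaN M -> shape_regular gamma M ->
  Ker_B Omega GammaD GammaN k M tau -> b_sup Omega GammaD k M tau = 0.
Proof.
move=> oO tri sr [_ kerb]; rewrite /b_sup; set S := [set _ | _ in _].
have S0 : S `<=` [set 0].
  move=> _ [w [Ww _] <-] /=; rewrite (form_b_broken_grad M).
  by rewrite (kerb _ (V_h_broken_grad oO tri sr Ww)) mul0r.
(* The set is empty when no admissible [w] exists; the default [sup set0 = 0] then agrees with the
   other case. *)
have [->|->] := subset_set1 S0; [exact: sup0|exact: sup1].
Qed.

(** * Coercivity of the form a *)

Lemma mxvec_entry (m n : nat) (k : 'I_(m * n)) :
  exists i j, forall (R : Type) (S : 'M[R]_(m, n)), mxvec S 0 k = S i j.
Proof.
by case/mxvec_indexP: k => i j; exists i, j => R S; rewrite mxvecE.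
Qed.

(** Integrability is tracked because a real-valued integral is [fine] of an extended one, which
    would turn an infinite value into 0 and spoil comparisons. *)
Definition L1_on (R : realType) (A : set 'rV[R]_3) (f : 'rV[R]_3 -> R) : Prop :=
  (leb3 R).-integrable (@of_coords R @^-1` A)
    (fun u : coords R => (f (of_coords u))%:E).

Lemma L1_on_sum (R : realType) (A : set 'rV[R]_3) (n : nat)
    (f : 'I_n -> 'rV[R]_3 -> R) :
  open A -> (forall i, L1_on A (f i)) -> L1_on A (fun x => \sum_i f i x).
Proof.
move=> oA fL; rewrite /L1_on; under eq_fun do rewrite -sumEFin.
apply: integrable_sum => [|i _]; last exact: fL.
exact: open_measurable_coords.
Qed.

(** The product is dominated almost everywhere by |K| (f^2 + g^2), where K is an essential bound of
    c. *)
Lemma L1_on_Linfty_L2 (R : realType) (A : set 'rV[R]_3)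
    (c f g : 'rV[R]_3 -> R) :
  open A -> in_Linfty A c -> in_L2 A f -> in_L2 A g ->
  L1_on A (fun x => c x * (f x * g x)).
Proof.
move=> oA [mc [K cK]] [mf fL] [mg gL].
have mA := open_measurable_coords oA.
have mcfg : measurable_fun (@of_coords R @^-1` A) (fun u : coords R =>
    c (of_coords u) * (f (of_coords u) * g (of_coords u))).
  by apply: measurable_funM => //; exact: measurable_funM.
have iG := integrableZl mA `|K| (integrableD mA fL gL).
apply/integrableP; split; first exact/measurable_EFinP.
have /integrableP[mG] := iG; apply: le_lt_trans.
apply: ae_ge0_le_integral => //.
- by apply: measurableT_comp => //; exact/measurable_EFinP.
- exact: measurableT_comp.
move: cK; rewrite /ae_on; apply: filterS => u cK Au.
rewrite -EFinD -EFinM !abse_EFin lee_fin; set F := f _; set G := g _.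
apply: le_trans (ler_norm _); rewrite normrM.
apply: ler_pM => //; first exact: le_trans (cK Au) (ler_norm K).
rewrite normrM -(real_normK (num_real F)) -(real_normK (num_real G)).
have := sqr_ge0 (`|F| - `|G|); rewrite sqrrB.
have := sqr_ge0 `|F|; have := sqr_ge0 `|G|; nra.
Qed.

Lemma in_Linfty_cst (R : realType) (A : set 'rV[R]_3) (a : R) :
  in_Linfty A (fun=> a).
Proof.
split; first exact: measurable_cst.
by exists `|a|; rewrite /ae_on; apply: aeW.
Qed.

Lemma L1_on_ddot (R : realType) (A : set 'rV[R]_3) (tau : 'rV[R]_3 -> 'M[R]_3) :
  open A -> (forall i j, in_L2 A (fun x => tau x i j)) ->
  L1_on A (fun x => ddot (tau x) (tau x)).
Proof.
move=> oA tauL; rewrite /ddot.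
apply: L1_on_sum => // i; apply: L1_on_sum => // j.
rewrite (_ : (fun _ => _) = fun x => 1 * (tau x i j * tau x i j)).
  exact: L1_on_Linfty_L2 (in_Linfty_cst A 1) _ _.
by apply/funext => x; rewrite mul1r.
Qed.

Lemma L1_on_tensor (R : realType) (A : set 'rV[R]_3)
    (C : 'rV[R]_3 -> 'M[R]_(3 * 3)) (tau : 'rV[R]_3 -> 'M[R]_3) :
  open A -> (forall i j, in_Linfty A (fun x => C x i j)) ->
  (forall i j, in_L2 A (fun x => tau x i j)) ->
  L1_on A (fun x => ddot (tensor_app (C x) (tau x)) (tau x)).
Proof.
move=> oA CL tauL; rewrite /ddot.
apply: L1_on_sum => // i; apply: L1_on_sum => // j.
rewrite (_ : (fun _ => _) = fun x =>
    \sum_k mxvec (tau x) 0 k * C x k (mxvec_index i j) * tau x i j); last first.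
  by apply/funext => x; rewrite /tensor_app mxE mxE mulr_suml.
apply: L1_on_sum => // k; have [i' [j' kE]] := mxvec_entry k.
rewrite (_ : (fun _ => _) = fun x =>
    C x k (mxvec_index i j) * (tau x i' j' * tau x i j)).
  exact: L1_on_Linfty_L2.
by apply/funext => x; rewrite kE; ring.
Qed.

(** Replacing g by [f \max g], which equals g almost everywhere on D, reduces the claim to an
    inequality valid at every point. *)
Lemma ae_le_Rintegral (d : measure_display) (T : measurableType d)
    (R : realType) (mu : {measure set T -> \bar R}) (D : set T) (f g : T -> R) :
  measurable D -> mu.-integrable D (EFin \o f) -> mu.-integrable D (EFin \o g) ->
  (forall x, 0 <= f x) -> {ae mu, forall x, D x -> f x <= g x} ->
  \int[mu]_(x in D) f x <= \int[mu]_(x in D) g x.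
Proof.
move=> mD fi gi f0 fg.
have mf : measurable_fun D f by apply/measurable_EFinP; case/integrableP: fi.
have mg : measurable_fun D g by apply/measurable_EFinP; case/integrableP: gi.
have mh := measurable_maxr mf mg.
apply: fine_le; [exact: integrable_fin_num fi|exact: integrable_fin_num gi|].
rewrite (@ae_eq_integral _ _ _ mu D (EFin \o (f \max g)) (EFin \o g)) //.
- apply: ge0_le_integral => //.
  + by move=> x _; rewrite lee_fin.
  + exact/measurable_EFinP.
  + exact/measurable_EFinP.
  + by move=> x _; rewrite lee_fin /= le_max lexx.
- exact/measurable_EFinP.
- exact/measurable_EFinP.
- by apply: filterS fg => x fg Dx /=; rewrite max_r // fg.
Qed.

Lemma form_a_coercive (R : realType) (Omega : set 'rV[R]_3)
    (E nu : 'rV[R]_3 -> R) :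
  open Omega -> elastic_material Omega E nu ->
  exists2 alpha : R, 0 < alpha &
    forall tau : 'rV[R]_3 -> 'M[R]_3,
      (forall x, Omega x -> (tau x)^T = tau x) ->
      (forall i j, in_L2 Omega (fun x => tau x i j)) ->
      alpha * vol_int Omega (fun x => ddot (tau x) (tau x)) <=
        form_a Omega E nu tau tau.
Proof.
move=> oO mat; have [_ [alpha alpha0 coer]] := mat_Cinv_spd mat.
exists alpha => // tau tauT tauL.
have mO := open_measurable_coords oO.
have iD := L1_on_ddot oO tauL.
rewrite -RintegralZl //; apply: ae_le_Rintegral => //.
- exact: (integrableZl mO alpha iD).
- exact: (L1_on_tensor oO (mat_Cinv_Linfty mat) tauL).
- by move=> u; rewrite mulr_ge0 ?ddot_ge0 // ltW.
- move: coer; rewrite /ae_on; apply: filterS => u cu Ou.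
  by apply: cu => //; exact: tauT.
Qed.

(** * The inverse trace inequality *)

(** The cube is centred at the centre of the inner ball with side r / 2. Its points are within r / 2
    of the centre, and the other half of the radius places them in the interior. The side being r /
    2, the constant 4 becomes 8. *)
Lemma elem_inner_box (R : realType) (Omega GammaD GammaN : set 'rV[R]_3)
    (M : mesh R) (gamma : R) (T : {set 'I_(nvtx M)}) :
  triangulation Omega GammaD GammaN M -> shape_regular gamma M ->
  T \in elts M ->
  exists a s, [/\ 0 < s, box a s `<=` @of_coords R @^-1` elem T,
    forall x, hull T x -> forall i,
      a 0 i - 8 * `|gamma| * s <= x 0 i <= a 0 i + s + 8 * `|gamma| * s
    & diam (hull T) <= 8 * `|gamma| * s].
Proof.
move=> tri sr TM; have [x0 [r [r0 x0r dr]]] := shape_regular_ball tri sr TM.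
have ds : diam (hull T) <= 8 * `|gamma| * (r / 2).
  by apply: le_trans dr _; rewrite le_eqVlt; apply/orP; left; apply/eqP; field.
exists (x0 - const_mx (r / 4)), (r / 2); split => //; first by rewrite divr_gt0.
- move=> u [[/= ]]; rewrite !in_itv /= !mxE => /andP[? ?] /andP[? ?] /andP[? ?].
  have ux : enorm (of_coords u - x0) <= 2 * (r / 4).
    apply: enorm_le_coord => i; rewrite !mxE ler_norml.
    case: i => [[|[|[|i]]] //= ltj].
    + by rewrite (_ : Ordinal ltj = 0); [lra|apply/val_inj].
    + by rewrite (_ : Ordinal ltj = 1); [lra|apply/val_inj].
    + by rewrite (_ : Ordinal ltj = 2%:R); [lra|apply/val_inj].
  have r2 : 0 < r / 2 by rewrite divr_gt0.
  apply: filterS (enorm_cball_nbhs (of_coords u) r2) => z /= zu; apply: x0r.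
  have -> : z - x0 = (z - of_coords u) + (of_coords u - x0) by rewrite addrA subrK.
  apply: le_trans (ler_enormD _ _) _; apply: le_trans (lerD zu ux) _; lra.
- move=> x Tx i; have Tx0 : hull T x0.
    by apply: x0r; rewrite subrr -(scale0r 0) enormZ normr0 mul0r ltW.
  have := le_trans (coord_le_enorm (x - x0) i) (le_trans (enorm_le_diam Tx Tx0) ds).
  rewrite !mxE ler_norml => /andP[? ?]; apply/andP; split; lra.
Qed.

(** 9 counts the tensor entries; the cube of 8 |gamma| pays for h_F times the area element, and the
    cube of [inverse_const] for the three coordinate directions. *)
Definition trace_const (R : realType) (k : nat) (gamma : R) : R :=
  9%:R * (8 * `|gamma| * inverse_const k (8 * `|gamma|)) ^+ 3.

Lemma trace_const_ge0 (R : realType) (k : nat) (gamma : R) :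
  0 <= trace_const k gamma.
Proof.
by rewrite mulr_ge0 // exprn_ge0 // !mulr_ge0 // inverse_const_ge0.
Qed.

(** The point lies on the segment from vertex 0 to the point of the opposite edge with parameter t /
    (s + t). *)
Lemma face_point_hull (R : realType) (M : mesh R) (F : {set 'I_(nvtx M)})
    (s t : R) :
  #|F| = 3%N -> 0 <= s -> 0 <= t -> s + t <= 1 ->
  hull F (fvtx F 0 + s *: (fvtx F 1 - fvtx F 0) + t *: (fvtx F 2 - fvtx F 0)).
Proof.
move=> F3 s0 t0 st1.
have [h0 h1 h2] : [/\ hull F (fvtx F 0), hull F (fvtx F 1) & hull F (fvtx F 2)].
  by split; exact: fvtx_hull.
have [st0|st0] := eqVneq (s + t) 0.
  have -> : s = 0 by lra.
  have -> : t = 0 by lra.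
  by rewrite !scale0r !addr0.
have ts : 0 <= t / (s + t) <= 1.
  have st : 0 < s + t by rewrite lt_neqAle eq_sym st0 addr_ge0.
  by rewrite divr_ge0 ?addr_ge0 //= ler_pdivrMr // mul1r lerDr.
have st01 : 0 <= s + t <= 1 by rewrite addr_ge0.
have := hull_convex h0 (hull_convex h1 h2 ts) st01.
set y := (X in hull F X -> _); set z := (X in _ -> hull F X).
suff -> : y = z by [].
by apply/rowP => i; rewrite !mxE; field.
Qed.

(** The parameter triangle is enclosed in the unit square, of measure 1, at the price of a factor
    2. *)
Lemma triangle_Rintegral_le (R : realType)
    (f : measurableTypeR R * measurableTypeR R -> R) (K : R) :
  let D := [set u : measurableTypeR R * measurableTypeR R |
             [/\ 0 <= u.1, 0 <= u.2 & u.1 + u.2 <= 1]] in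
  0 <= K -> (forall u, D u -> 0 <= f u <= K) ->
  (\int[leb2 R]_(u in D) f u)%R <= K.
Proof.
move=> D K0 fK.
pose I : set R := [set` `[0, 1]].
have muI : @lebesgue_measure R I = 1%E.
  by rewrite /I lebesgue_measure_itv /= lte_fin ltr01 oppr0 adde0.
have le1 : (\int[leb2 R]_(u in D) (f u)%:E <= K%:E)%E.
  apply: le_trans (_ : \int[leb2 R]_(u in I `*` I) cst K%:E u <= _)%E.
    apply: ge0_le_integral_set => [u /fK /andP[]|u _||u /fK /andP[]] //=.
    by move=> u [u1 u2 u12]; split; rewrite /I /= in_itv /=; apply/andP; split; lra.
  rewrite integral_cst; last by apply: measurableX; exact: measurable_itv.
  have E := product_measure1E (@lebesgue_measure R) (@lebesgue_measure R)
    (measurable_itv `[0, 1]) (measurable_itv `[0, 1]).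
  have E1 : (leb2 R (I `*` I) <= 1)%E.
    rewrite le_eqVlt; apply/orP; left; apply/eqP; rewrite [LHS]E.
    by apply: (etrans (congr2 mule muI muI)); rewrite mule1.
  rewrite -[leRHS]mule1; apply: lee_wpmul2l; last exact: E1.
  by rewrite lee_fin.
have ge0 : (0 <= \int[leb2 R]_(u in D) (f u)%:E)%E.
  by apply: integral_ge0 => u /fK /andP[? _]; rewrite lee_fin.
rewrite /Rintegral -lee_fin fineK //.
by rewrite ge0_fin_numE // (le_lt_trans le1) // ltry.
Qed.

Section trace_inequality.
Variables (R : realType) (Omega GammaD GammaN : set 'rV[R]_3) (M : mesh R).
Variables (gamma : R) (k : nat) (tau : 'rV[R]_3 -> 'M[R]_3).
Hypothesis dom : domain_setting Omega GammaD GammaN.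
Hypothesis tri : triangulation Omega GammaD GammaN M.
Hypothesis sr : shape_regular gamma M.
Hypothesis Stau : Sigma_h Omega GammaN k M tau.

Let energy (A : set 'rV[R]_3) : R := vol_int A (fun x => ddot (tau x) (tau x)).

Lemma elem_sub T : T \in elts M -> elem T `<=` Omega.
Proof.
move=> TM; apply: subset_trans (interior_closure_lipschitz (dom_open dom) (dom_lipschitz dom)).
by apply: interiorS; exact: (hull_sub_closure tri).
Qed.

Lemma elem_measurable (T : {set 'I_(nvtx M)}) :
  measurable (@of_coords R @^-1` elem T : set (coords R)).
Proof. by apply: open_measurable_coords; exact: open_interior. Qed.

Lemma energy_fin_num T : T \in elts M ->
  (\int[leb3 R]_(u in @of_coords R @^-1` elem T)
     (ddot (tau (of_coords u)) (tau (of_coords u)))%:E)%E \is a fin_num.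
Proof.
move=> TM; apply: integrable_fin_num; first exact: elem_measurable.
have mO := open_measurable_coords (dom_open dom).
apply: (integrableS mO (elem_measurable T)).
  by move=> u; exact: elem_sub.
exact: (L1_on_ddot (dom_open dom) (Sigma_L2 Stau)).
Qed.

Lemma energy_ge0 A : 0 <= energy A.
Proof. by apply: Rintegral_ge0 => u _; exact: ddot_ge0. Qed.

(** The squared component is at most the sum of the nine squared entries of the trace. Each entry is
    a polynomial evaluated at x, a point outside the open element, which the inverse estimate
    reaches from the cube. *)
Lemma nn_trace_le T (F : {set 'I_(nvtx M)}) a s x :
  T \in elts M -> F \subset T -> hull F x -> 0 < s ->
  box a s `<=` @of_coords R @^-1` elem T ->
  (forall i, a 0 i - 8 * `|gamma| * s <= x 0 i <= a 0 i + s + 8 * `|gamma| * s) ->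
  s ^+ 3 * nn_trace T F tau x ^+ 2 <=
    9%:R * inverse_const k (8 * `|gamma|) ^+ 3 * energy (elem T).
Proof.
move=> TM FT Fx s0 sT ax.
set C := inverse_const _ _.
apply: le_trans (ler_wpM2l (exprn_ge0 3 (ltW s0))
  (sqr_nn_comp_le (trace T tau x) (dot_normalized_le1 (fcross F)))) _.
rewrite /ddot mulr_sumr.
have entry i j : s ^+ 3 * (trace T tau x i j * trace T tau x i j) <=
    C ^+ 3 * energy (elem T).
  have [p [sp pE]] := Sigma_poly Stau TM i j.
  have Tx : closure (elem T) x.
    by apply: (hull_closure_elem tri sr TM); exact: hullS Fx.
  rewrite (trace_meval Tx pE) -expr2.
  have M0 : 0 <= 8 * `|gamma| by rewrite mulr_ge0.
  rewrite -lee_fin [leRHS]EFinM /energy /vol_int /Rintegral fineK ?energy_fin_num //.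
  apply: (le_trans (inverse_estimate_3d s0 M0 sp ax)).
  apply: lee_wpmul2l; first by rewrite lee_fin exprn_ge0 // inverse_const_ge0.
  apply: ge0_le_integral_set => // [u _|u _|u /sT Tu].
  - by rewrite lee_fin sqr_ge0.
  - by rewrite lee_fin ddot_ge0.
  rewrite lee_fin -pE // /ddot (bigD1 i) //= (bigD1 j) //= -expr2 -addrA lerDl.
  by rewrite addr_ge0 //; repeat (apply: sumr_ge0 => ? _); rewrite -expr2 sqr_ge0.
apply: le_trans (_ : \sum_(i < 3) \sum_(j < 3) C ^+ 3 * energy (elem T) <= _).
  by apply: ler_sum => i _; rewrite mulr_sumr; apply: ler_sum => j _; exact: entry.
by rewrite !sumr_const card_ord le_eqVlt; apply/orP; left; apply/eqP; ring.
Qed.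

Lemma face_trace_inequality T (F : {set 'I_(nvtx M)}) :
  T \in elts M -> F \subset T -> #|F| = 3%N ->
  mesh_size F * face_int F (fun x => nn_trace T F tau x ^+ 2) <=
    trace_const k gamma * energy (elem T).
Proof.
move=> TM FT F3; have [a [s [s0 sT ax ds]]] := elem_inner_box tri sr TM.
set m := 8 * `|gamma| in ax ds; set C := inverse_const k m.
have m0 : 0 <= m by rewrite mulr_ge0.
pose K := 9%:R * C ^+ 3 * energy (elem T) / s ^+ 3.
have K0 : 0 <= K.
  rewrite divr_ge0 ?exprn_ge0 ?(ltW s0) // mulr_ge0 ?energy_ge0 //.
  by rewrite mulr_ge0 // exprn_ge0 // inverse_const_ge0.
have h0 : 0 <= mesh_size F by exact: diam_ge0.
have hs : mesh_size F <= m * s by apply: le_trans ds; exact: diamS.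
have ms : 0 <= m * s by rewrite mulr_ge0 // ltW.
have edge n : (n < 3)%N -> enorm (fvtx F n - fvtx F 0) <= m * s.
  by move=> n3; apply: le_trans hs; apply: enorm_le_diam; exact: fvtx_hull.
have cs : enorm (fcross F) <= m * s * (m * s).
  apply: le_trans (enorm_cross_le _ _) _.
  by apply: ler_pM; rewrite ?enorm_ge0 ?edge.
rewrite /face_int mulrA.
(* Three factors m s bound h_F and the area element, and K bounds the squared trace on the face; the
   s^3 cancels against the denominator of K. *)
apply: le_trans (_ : m * s * (m * s * (m * s)) * K <= _); last first.
  rewrite /K /trace_const -/m -/C le_eqVlt; apply/orP; left; apply/eqP.
  by field; rewrite gt_eqF.
apply: ler_pM.
- by rewrite mulr_ge0 ?enorm_ge0.
- by apply: Rintegral_ge0 => u _; rewrite sqr_ge0.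
- by apply: ler_pM; rewrite ?enorm_ge0.
apply: triangle_Rintegral_le => // u [u1 u2 u12]; rewrite sqr_ge0 /=.
rewrite ler_pdivlMr ?exprn_gt0 // mulrC; apply: nn_trace_le sT _ => //.
  exact: face_point_hull.
by move=> i; apply: ax; apply: (hullS FT); exact: face_point_hull.
Qed.

(** Additivity over the disjoint open elements, then monotonicity, since their union lies in
    Omega. *)
Lemma sum_energy_elem : \sum_(T in elts M) energy (elem T) <= energy Omega.
Proof.
have mO := open_measurable_coords (dom_open dom).
have iO := L1_on_ddot (dom_open dom) (Sigma_L2 Stau).
rewrite /energy /vol_int /Rintegral sum_fine; last by move=> T; exact: energy_fin_num.
rewrite -big_enum /=.
have tI : trivIset [set` enum (elts M)] (fun T => @of_coords R @^-1` elem T).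
  apply/trivIsetP => T T'; rewrite /= !mem_enum => TM T'M TT'.
  by rewrite -preimage_setI (elem_disjoint tri TM T'M TT') preimage_set0.
pose D := \big[setU/set0]_(T <- enum (elts M)) (@of_coords R @^-1` elem T).
have sub : D `<=` @of_coords R @^-1` Omega.
  rewrite /D big_seq; elim/big_rec: _ => // T B; rewrite mem_enum => TM IH u [|/IH //].
  exact: elem_sub.
have mf : measurable_fun D
   (fun u : coords R => (ddot (tau (of_coords u)) (tau (of_coords u)))%:E).
  by apply: measurable_funS sub _ => //; case/integrableP: iO.
have mD : measurable D.
  by apply: bigsetU_measurable => T _; exact: elem_measurable.
rewrite -(ge0_integral_bigsetU (leb3 R) elem_measurable (enum_uniq _) tI mf); last first.
  by move=> u _; rewrite lee_fin ddot_ge0.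
apply: fine_le.
- apply: integrable_fin_num => //; exact: integrableS mO mD sub iO.
- by apply: integrable_fin_num; [exact: mO|exact: iO].
- by apply: ge0_le_integral_set => // u _; rewrite lee_fin ddot_ge0.
Qed.

End trace_inequality.

(** * Summation over the faces and the final estimate *)

Lemma face_eltP (R : realType) (M : mesh R) (F : {set 'I_(nvtx M)}) :
  is_face F -> face_elt F \in elts M /\ F \subset face_elt F.
Proof.
move=> /andP[_ /existsP[T /andP[TM FT]]]; rewrite /face_elt.
by case: pickP => [T' /andP[]//|/(_ T)]; rewrite TM FT.
Qed.

(* A tetrahedron has at most 2^4 subsets of vertices, a crude bound for its
   number of faces. *)
Lemma sum_face_trace_le (R : realType) (Omega GammaD GammaN : set 'rV[R]_3)
    (M : mesh R) (gamma : R) (k : nat) (tau : 'rV[R]_3 -> 'M[R]_3) :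
  domain_setting Omega GammaD GammaN -> triangulation Omega GammaD GammaN M ->
  shape_regular gamma M -> Sigma_h Omega GammaN k M tau ->
  \sum_(F : {set 'I_(nvtx M)} | is_face F)
    mesh_size F * face_int F (fun x => nn_trace (face_elt F) F tau x ^+ 2) <=
  16%:R * trace_const k gamma * vol_int Omega (fun x => ddot (tau x) (tau x)).
Proof.
move=> dom tri sr Stau; set C := trace_const k gamma.
pose e (T : {set 'I_(nvtx M)}) := vol_int (elem T) (fun x => ddot (tau x) (tau x)).
have C0 : 0 <= C by exact: trace_const_ge0.
have Ce0 T : 0 <= C * e T by rewrite mulr_ge0 // energy_ge0.
apply: le_trans (_ : \sum_(F : {set 'I_(nvtx M)} | is_face F) C * e (face_elt F) <= _).
  apply: ler_sum => F faceF; have [TM FT] := face_eltP faceF.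
  apply: (face_trace_inequality dom tri sr Stau TM FT).
  by case/andP: faceF => /eqP.
(* Grouping the faces by the element chosen for them counts each element energy at most 16 times. *)
rewrite (partition_big (@face_elt R M) (fun T => T \in elts M)); last first.
  by move=> F /face_eltP[].
apply: le_trans (_ : \sum_(T in elts M) 16%:R * (C * e T) <= _); last first.
  rewrite -mulr_sumr -mulr_sumr mulrA; apply: ler_wpM2l; first by rewrite mulr_ge0.
  exact: sum_energy_elem dom tri Stau.
apply: ler_sum => T TM.
rewrite (eq_bigr (fun=> C * e T)); last by move=> F /andP[_ /eqP ->].
rewrite sumr_const -[leLHS]mulr_natl; apply: ler_wpM2r => //; rewrite ler_nat.
have -> : 16%N = #|powerset T| by rewrite card_powerset (tri_card tri TM).
apply: subset_leq_card; apply/fintype.subsetP => F; rewrite inE => /andP[faceF /eqP TE].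
by rewrite -TE; have [] := face_eltP faceF.
Qed.

Theorem lemma14 (R : realType) (Omega GammaD GammaN : set 'rV[R]_3)
    (E nu : 'rV[R]_3 -> R) (k : nat) (gamma : R) :
  domain_setting Omega GammaD GammaN ->
  elastic_material Omega E nu ->
  (1 <= k)%N ->
  exists2 c : R, 0 < c &
    forall M : mesh R,
      triangulation Omega GammaD GammaN M ->
      shape_regular gamma M ->
      forall tau : 'rV[R]_3 -> 'M[R]_3,
        Ker_B Omega GammaD GammaN k M tau ->
        c * Sigma_norm Omega GammaD k M tau ^+ 2 <= form_a Omega E nu tau tau.
Proof.
move=> dom mat _.
have [alpha alpha0 coer] := form_a_coercive (dom_open dom) mat.
set C := 16%:R * trace_const k gamma.
have C1 : 0 < 1 + C by rewrite ltr_pwDl // mulr_ge0 // trace_const_ge0.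
(* With the supremum gone, the squared norm is at most (1 + C) times the squared L^2 norm. The
   constant is fixed before the mesh and depends on the material, gamma and k. *)
exists (alpha / (1 + C)) => [|M tri sr tau kerb]; first by rewrite divr_gt0.
have [Stau _] := kerb.
apply: le_trans (coer tau (Sigma_sym Stau) (Sigma_L2 Stau)).
set V := vol_int Omega _; have V0 : 0 <= V by exact: energy_ge0.
have faces := sum_face_trace_le dom tri sr Stau.
rewrite /Sigma_norm (b_sup_eq0 (dom_open dom) tri sr kerb) expr0n addr0.
rewrite -/V -/C in faces *; set S := \sum_(F | _) _ in faces *.
have S0 : 0 <= S.
  apply: sumr_ge0 => F _; rewrite mulr_ge0 ?diam_ge0 // mulr_ge0 ?enorm_ge0 //.
  by apply: Rintegral_ge0 => u _; rewrite sqr_ge0.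
rewrite sqr_sqrtr ?addr_ge0 // -mulrA ler_wpM2l // ?(ltW alpha0) //.
by rewrite mulrC ler_pdivrMr // mulrDr mulr1 lerD2l mulrC.
Qed.
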